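(* There is a polynomial-time reduction from EOS $(\le_f,\omega)$-coverability to cEOS $\le_f$-coverability.
   Context: EOS: A PN is $(P,T,F)$ with $F:(P\times T)\cup(T\times P)\to\mathbb N$, ${\tt pre}_N(t)(p)=F(p,t)$, ${\tt post}_N(t)(p)=F(t,p)$; $\blacksquare=(\emptyset,\emptyset,\emptyset)$ with unique marking $\varepsilon$. An EOS is $(\hat N,\mathcal N,d,\Theta)$: system PN $\hat N=(\hat P,\hat T,\hat F)$ containing idle transitions $id_p$ ($p\in\hat P$) consuming and producing one token on $p$ only; finite set $\mathcal N\ni\blacksquare$ of object PNs, all nets pairwise disjoint; typing $d:\hat P\to\mathcal N$; finite event set $\Theta$ of pairs $(\hat\tau,\theta)$, $\hat\tau\in\hat T$, $\theta(N)$ a finite multiset of transitions of $N$, with $\theta(d(p))\ne\emptyset$ if $\hat\tau=id_p$. Configurations: finite multisets of nested tokens $(\hat p,m)$, $m$ a marking of $d(\hat p)$. With $\Pi^1(\sum_i(\hat p_i,m_i))=\sum_i\hat p_i$, $\Pi^2_N(\sum_i(\hat p_i,m_i))=\sum_{d(\hat p_i)=N}m_i$: event $(\hat\tau,\theta)$ fires on $\mu$ with mode $(\lambda,\rho)$ iff $\lambda\sqsubseteq\mu$, $\Pi^1(\lambda)={\tt pre}_{\hat N}(\hat\tau)$, $\Pi^1(\rho)={\tt post}_{\hat N}(\hat\tau)$, and for all $N$: $\Pi^2_N(\lambda)\ge{\tt pre}_N(\theta(N))$, $\Pi^2_N(\rho)=\Pi^2_N(\lambda)-{\tt pre}_N(\theta(N))+{\tt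 post}_N(\theta(N))$; result $\mu-\lambda+\rho$. $\mu\le_f\mu'$ iff $\mu'$ arises from $\mu$ by adding tokens inside existing nested tokens and/or adding nested tokens. A cEOS is an EOS with $d(\mathrm{supp}\,{\tt pre}_{\hat N}(\hat t))\subseteq d(\mathrm{supp}\,{\tt post}_{\hat N}(\hat t))$ for all $\hat t$. A $(\le_f,\omega)$-run is a finite sequence of configurations where each consecutive pair is either a firing step $C_i\to^e C_{i+1}$ or a lossy step $C_{i+1}\le_f C_i$. EOS $(\le_f,\omega)$-coverability: given an EOS, initial $\mu_0$, target $\mu_1$, is there a $(\le_f,\omega)$-run from $\mu_0$ to some $\mu\ge_f\mu_1$? cEOS $\le_f$-coverability: given a cEOS, $\mu_0$, $\mu_1$, is there a (standard) run from $\mu_0$ to some $\mu\ge_f\mu_1$? *)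

(* Defs.v *)
From Stdlib Require Import Relation_Operators BinNums.
From Stdlib Require List.
From HB Require Import structures.
From mathcomp Require Import all_boot.
From mathcomp Require Import finmap multiset.

Set Implicit Arguments.
Unset Strict Implicit.
Unset Printing Implicit Defensive.

Local Open Scope nat_scope.

(** * Deterministic multi-tape Turing machines and polynomial time *)

Inductive move := MoveL | Stay | MoveR.

(* A two-way infinite tape as a zipper: [tleft] lists the cells to the left of
   the head, nearest first; [tright] lists the scanned cell and the cells to
   its right.  All cells that are not listed are blank, and [None] is the blank
   symbol. *)
Record tape (A : Type) := Tape { tleft : seq (option A); tright : seq (option A) }.

Definition scanned (A : Type) (t : tape A) : option A := head None (tright t).

Definition write_move (A : Type) (t : tape A) (am : option A * move) : tape A :=
  let: (a, m) := am in
  match m with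
  | MoveL => Tape (behead (tleft t)) [:: head None (tleft t), a & behead (tright t)]
  | Stay => Tape (tleft t) (a :: behead (tright t))
  | MoveR => Tape (a :: tleft t) (behead (tright t))
  end.

(* [S] is the input/output alphabet; the machine may use the additional
   symbols [tm_aux].  It has [tm_k.+1] tapes, the first of which is both the
   input and the output tape, and it halts when [tm_delta] returns [None]. *)
Record TM (S : finType) := MkTM {
  tm_k : nat;
  tm_aux : finType;
  tm_state : finType;
  tm_start : tm_state;
  tm_delta : tm_state -> {ffun 'I_tm_k.+1 -> option (S + tm_aux)} ->
             option (tm_state * {ffun 'I_tm_k.+1 -> option (S + tm_aux) * move})
}.

Definition tm_conf (S : finType) (M : TM S) : Type :=
  (tm_state M * {ffun 'I_(tm_k M).+1 -> tape (S + tm_aux M)})%type.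

Definition tm_step (S : finType) (M : TM S) (c : tm_conf M) : option (tm_conf M) :=
  if tm_delta c.1 [ffun i => scanned (c.2 i)] is Some (q, a)
  then Some (q, [ffun i => write_move (c.2 i) (a i)]) else None.

Definition input_cells (S : finType) (X : Type) (w : seq S) : seq (option (S + X)) :=
  [seq Some (inl s) | s <- w].

Definition tm_init (S : finType) (M : TM S) (w : seq S) : tm_conf M :=
  (tm_start M,
   [ffun i => Tape [::] (if i == ord0 then input_cells (tm_aux M) w else [::])]).

(* On input [w], [M] halts after exactly [t] steps; the output [w'] is the word
   on the first tape from the head up to the first blank. *)
Definition tm_computes_in (S : finType) (M : TM S) (w w' : seq S) (t : nat) : Prop :=
  exists c : tm_conf M,
    [/\ iter t (obind (@tm_step S M)) (Some (tm_init M w)) = Some c,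
        tm_step c = None
      & exists2 r, tright (c.2 ord0) = input_cells (tm_aux M) w' ++ r &
                   head None r = None].

Definition poly_time_computable (S : finType) (A B : Type)
    (encA : A -> seq S) (encB : B -> seq S) (f : A -> B) : Prop :=
  exists (M : TM S) (c : nat), forall x : A,
    exists2 t, t <= c * size (encA x) ^ c + c &
               tm_computes_in M (encA x) (encB (f x)) t.

Record problem (S : finType) := Problem {
  pb_instance : Type;
  pb_encode : pb_instance -> seq S;
  pb_yes : pb_instance -> Prop
}.

Definition poly_time_reduction (S : finType) (P Q : problem S)
    (f : pb_instance P -> pb_instance Q) : Prop :=
  poly_time_computable (@pb_encode S P) (@pb_encode S Q) f /\
  forall x, pb_yes x <-> pb_yes (f x).

(** * Petri nets and elementary object systems *)

(* The flow function F is split into its restrictions to P x T and T x P. *)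
Record pn := PN {
  place : finType;
  trans : finType;
  flow_pt : place -> trans -> nat;
  flow_tp : trans -> place -> nat
}.

Definition pre (N : pn) (t : trans N) (p : place N) : nat := flow_pt p t.
Definition post (N : pn) (t : trans N) (p : place N) : nat := flow_tp t p.

Notation marking N := {ffun place N -> nat}.

(* Finite multisets of transitions of N, and the linear extensions of pre and
   post to them. *)
Notation tmultiset N := {ffun trans N -> nat}.

Definition mpre (N : pn) (th : tmultiset N) (p : place N) : nat :=
  \sum_(t : trans N) th t * pre t p.
Definition mpost (N : pn) (th : tmultiset N) (p : place N) : nat :=
  \sum_(t : trans N) th t * post t p.

Definition empty_pn (N : pn) : bool := (#|place N| == 0) && (#|trans N| == 0).

(* The set of object nets is a family [net] indexed by the finite type [obj];
   the nets are pairwise disjoint because their places and transitions live in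
   different summands.  Elements of [obj] are identified with nets, hence
   [black] is the only index of an empty net.  [idle p] is id_p. *)
Record eos := EOS {
  sys : pn;
  idle : place sys -> trans sys;
  obj : finType;
  net : obj -> pn;
  black : obj;
  typ : place sys -> obj;
  events : seq (trans sys * {dffun forall n : obj, tmultiset (net n)});
  idle_pre : forall p q, pre (idle p) q = (q == p);
  idle_post : forall p q, post (idle p) q = (q == p);
  blackP : forall n, empty_pn (net n) = (n == black);
  events_uniq : uniq events;
  events_idle : forall e, e \in events -> forall p, e.1 = idle p ->
    exists t, e.2 (typ p) t != 0
}.

Definition event (E : eos) : Type :=
  (trans (sys E) * {dffun forall n : obj E, tmultiset (net n)})%type.

Definition conservative (E : eos) : Prop :=
  forall t : trans (sys E),
    (@typ E) @: [set p | 0 < pre t p] \subset (@typ E) @: [set p | 0 < post t p].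

(** ** Configurations and firing *)

Definition ntoken (E : eos) : choiceType :=
  {p : place (sys E) & marking (net (typ p))}.

Definition NTok (E : eos) (p : place (sys E)) (m : marking (net (typ p))) : ntoken E :=
  Tagged (fun p => marking (net (typ p))) m.

Definition nplace (E : eos) (x : ntoken E) : place (sys E) := tag x.
Definition nmarking (E : eos) (x : ntoken E) : marking (net (typ (nplace x))) := tagged x.

Notation config E := {mset ntoken E}%mset.

Definition Pi1 (E : eos) (mu : config E) (p : place (sys E)) : nat :=
  \sum_(x <- mu | nplace x == p) 1.

(* The marking of a nested token, tagged with the net it is a marking of. *)
Definition content (E : eos) (x : ntoken E) : {n : obj E & marking (net n)} :=
  Tagged (fun n => marking (net n)) (nmarking x).

(* [untag 0 N _ (content x)] is 0 unless d(nplace x) = N. *)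
Definition Pi2 (E : eos) (N : obj E) (mu : config E) (q : place (net N)) : nat :=
  \sum_(x <- mu) untag 0 (fun m : marking (net N) => m q) (content x).

Definition fires_with (E : eos) (e : event E) (mu la rh mu' : config E) : Prop :=
  [/\ (la `<=` mu)%mset,
      forall p, Pi1 la p = pre e.1 p,
      forall p, Pi1 rh p = post e.1 p,
      forall (N : obj E) (q : place (net N)),
        mpre (e.2 N) q <= Pi2 la q /\
        Pi2 rh q = Pi2 la q - mpre (e.2 N) q + mpost (e.2 N) q
    & mu' = ((mu `\` la) `+` rh)%mset].

Definition fires (E : eos) (mu mu' : config E) : Prop :=
  exists2 e, e \in events E & exists la rh, fires_with e mu la rh mu'.

Inductive ntoken_le (E : eos) : ntoken E -> ntoken E -> Prop :=
  NTokenLe (p : place (sys E)) (m m' : marking (net (typ p))) of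
    (forall q, m q <= m' q) : ntoken_le (NTok m) (NTok m').

Definition le_f (E : eos) (mu mu' : config E) : Prop :=
  exists s s' r : seq (ntoken E),
    [/\ mu = seq_mset s, mu' = seq_mset (s' ++ r) & List.Forall2 (@ntoken_le E) s s'].

Definition run (E : eos) : config E -> config E -> Prop :=
  clos_refl_trans_1n (config E) (@fires E).

Definition lossy_run (E : eos) : config E -> config E -> Prop :=
  clos_refl_trans_1n (config E) (fun mu mu' => fires mu mu' \/ le_f mu' mu).

(** * Encoding of instances *)

(* [inl b] is a binary digit, [inr true] and [inr false] are an opening and a
   closing bracket. *)
Definition symbol : finType := (bool + bool)%type.

Definition bracket (w : seq symbol) : seq symbol :=
  inr true :: w ++ [:: inr false].

Definition enc_list (ws : seq (seq symbol)) : seq symbol := bracket (flatten ws).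

Fixpoint pos_bits (n : positive) : seq bool :=
  match n with
  | xH => [:: true]
  | xO n' => false :: pos_bits n'
  | xI n' => true :: pos_bits n'
  end.

(* Binary, least significant digit first; no digits for 0. *)
Definition enc_nat (n : nat) : seq symbol :=
  bracket [seq inl b | b <- if bin_of_nat n is Npos p then pos_bits p else [::]].

Definition enc_elt (T : finType) (x : T) : seq symbol := enc_nat (index x (enum T)).

Definition enc_fun (T : finType) (f : T -> nat) : seq symbol :=
  enc_list [seq enc_nat (f x) | x <- enum T].

Definition enc_pn (N : pn) : seq symbol :=
  enc_list [:: enc_list [seq enc_fun (@flow_pt N p) | p <- enum (place N)];
               enc_list [seq enc_fun (@flow_tp N t) | t <- enum (trans N)]].

Definition enc_event (E : eos) (e : event E) : seq symbol :=
  enc_list [:: enc_elt e.1; enc_list [seq enc_fun (e.2 n) | n <- enum (obj E)]].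

Definition enc_eos (E : eos) : seq symbol :=
  enc_list [:: enc_pn (sys E);
               enc_list [seq enc_elt (idle p) | p <- enum (place (sys E))];
               enc_list [seq enc_pn (net n) | n <- enum (obj E)];
               enc_elt (black E);
               enc_list [seq enc_elt (typ p) | p <- enum (place (sys E))];
               enc_list [seq enc_event e | e <- events E]].

(* A configuration is presented as a list of nested tokens with multiplicities,
   the latter being written in binary. *)
Definition presentation (E : eos) : Type := seq (ntoken E * nat).

Definition config_of (E : eos) (s : presentation E) : config E :=
  seq_mset (tally_seq s).

Definition enc_config (E : eos) (s : presentation E) : seq symbol :=
  enc_list [seq enc_list [:: enc_elt (nplace x.1); enc_fun (nmarking x.1); enc_nat x.2]
           | x <- s].

(** * The decision problems *)

Record cov_instance := CovInstance {
  ci_eos : eos;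
  ci_init : presentation ci_eos;
  ci_target : presentation ci_eos
}.

Definition enc_cov (x : cov_instance) : seq symbol :=
  enc_list [:: enc_eos (ci_eos x); enc_config (ci_init x); enc_config (ci_target x)].

Definition EOS_lossy_coverability : problem symbol :=
  Problem enc_cov (fun x =>
    exists2 mu, lossy_run (config_of (ci_init x)) mu & le_f (config_of (ci_target x)) mu).

Definition cEOS_coverability : problem symbol :=
  @Problem symbol {x : cov_instance | conservative (ci_eos x)}
    (fun x => enc_cov (sval x))
    (fun x => exists2 mu, run (config_of (ci_init (sval x))) mu &
                          le_f (config_of (ci_target (sval x))) mu).

(* Main.v *)
Require Import Defs.
From Stdlib Require Import Relation_Operators BinNums BinNat BinPos.
From Stdlib Require List.
From mathcomp Require Import all_boot.
From mathcomp Require Import finmap multiset zify.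

(** The conservative system gets one trash place per object net, on which every
    transition also drops a nested token: firing with trash loses object tokens,
    and what lies in the trash is never read again.  Conversely, losses are
    simulated by leaving the superfluous tokens in place until the nested tokens
    carrying them are consumed, whereupon they go into the trash.  Events that
    produce tokens of a net for which they output no nested token can never fire
    in the given system, and are deleted because the trash would enable them.

    For the running time, an encoding is the bracketed word of a tree.  A Turing
    machine whose first tape is a stack of such words evaluates tree functions in
    place on top of the stack; the functions computed in polynomial time in this
    way are closed under composition, list operations, conditionals and folds
    with polynomially bounded accumulators, and the reduction is written with
    these. *)

Set Implicit Arguments.
Unset Strict Implicit.
Unset Printing Implicit Defensive.

Local Open Scope nat_scope.

(** * Structured programs on four stacks *)

(** Conservativity comes for free once every ordinary transition outputs to places of all types. The
    trash needs one place per net because a nested token can only hold a marking of its own net. The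
    delicate direction is the way back: what a firing puts into the trash may be tokens carried over
    from its input or tokens it has just produced, so one firing of the new system becomes a loss, a
    firing and a second loss in the given one. The intermediate output has to hold everything the
    event produces, and this requires an output token of the right type.

    On the machine side, the encoding of a tree is self-delimiting, so its end is found by counting
    brackets. Moving a word between stacks reverses it; two buffers suffice to duplicate, exchange
    and regroup trees, and the fourth tape holds the bracket depth. Elements of finite types are
    written as positions in an enumeration, and a sum type enumerates its left summand first. Hence
    the given system keeps its numbering, and the reduction appends rows and columns to its flow
    matrices. *)

Notation cell := (option (symbol + void)).
Notation tapes := {ffun 'I_4 -> tape (symbol + void)}.

(* Exiting ([None]) is a transition rather than a state: sequencing and looping
   then only redirect exits. *)
Record mach := Mach {
  mstate : finType;
  mstart : mstate;
  mdelta : mstate -> {ffun 'I_4 -> cell} ->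
           option mstate * {ffun 'I_4 -> cell * move}
}.

Inductive mexec (M : mach) : option (mstate M) -> tapes -> nat -> tapes -> Prop :=
| mexec_exit (t : tapes) : mexec None t 0 t
| mexec_step q (t : tapes) n (t' : tapes) :
    mexec (mdelta q [ffun i => scanned (t i)]).1
      [ffun i => write_move (t i) ((mdelta q [ffun j => scanned (t j)]).2 i)] n t' ->
    mexec (Some q) t n.+1 t'.
Arguments mexec M : clear implicits.

Definition mach_TM (M : mach) : TM symbol :=
  @MkTM symbol 3 void (option (mstate M)) (Some (mstart M))
    (fun q c => if q is Some q' then Some (mdelta q' c) else None).

Lemma mexec_iter (M : mach) q t n t' : mexec M q t n t' ->
  iter n (obind (@tm_step symbol (mach_TM M))) (Some (q, t)) = Some (None, t').
Proof.
elim=> {q t n t'} [//|q t n t' _ IH]; rewrite iterSr -IH; congr iter.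
by rewrite /= /tm_step /=; case: (mdelta q _).
Qed.

(* The head scans the top of the stack, and everything else is blank. *)
Definition tape_stack (t : tape (symbol + void)) (s : seq symbol) : Prop :=
  exists j k, tleft t = nseq j None /\ tright t = input_cells void s ++ nseq k None.

Definition stacks := 'I_4 -> seq symbol.

Definition holds (t : tapes) (S : stacks) : Prop := forall i, tape_stack (t i) (S i).

(** The run must exist for every choice of tapes holding [S]: earlier programs leave an unknown
    number of listed blanks, and specifications quantified in this way compose. [b] is only an upper
    bound, so that it can be rounded up. *)
Record exec (M : mach) (S : stacks) (b : nat) (S' : stacks) : Prop := Exec {
  exec_run : forall t, holds t S ->
    exists t' n, [/\ n <= b, holds t' S' & mexec M (Some (mstart M)) t n t']
}.

Lemma exec_ext M S b S' S1 S2 b' :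
  exec M S b S' -> S =1 S1 -> S' =1 S2 -> b <= b' -> exec M S1 b' S2.
Proof.
move=> [H] e1 e2 le; split=> t ht.
have /H [t' [n [nb ht' ev]]] : holds t S by move=> i; rewrite e1.
exists t', n; split => //; first exact: leq_trans le.
by move=> i; rewrite -e2.
Qed.

Definition upd (S : stacks) i s : stacks := fun j => if j == i then s else S j.

Definition act1 i am (c : {ffun 'I_4 -> cell}) : {ffun 'I_4 -> cell * move} :=
  [ffun j => if j == i then am else (c j, Stay)].

Lemma scanned_stack t s : tape_stack t s -> scanned t = omap inl (ohead s).
Proof. by case=> j [k [_ e]]; rewrite /scanned e; case: s {e} => [|a s] //; case: k. Qed.

Lemma stay_stack t s : tape_stack t s -> tape_stack (write_move t (scanned t, Stay)) s.
Proof.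
move=> ts; have := scanned_stack ts; case: ts => j [k [e1 e2]] es.
rewrite es /tape_stack /= e1 e2.
(* On an empty stack the scanned blank is written back explicitly, which lists a cell even if [k] is
   0; hence [k.-1.+1]. *)
case: s {es e2} => [|a s]; first by exists j, k.-1.+1; case: k.
by exists j, k.
Qed.

Definition mpop i : mach :=
  @Mach unit tt (fun _ c => (None, act1 i (None, MoveR) c)).

Lemma exec_pop i S : exec (mpop i) S 1 (upd S i (behead (S i))).
Proof.
split=> t ht; pose t1 : tapes :=
  [ffun j => write_move (t j) (act1 i (None, MoveR) [ffun j0 => scanned (t j0)] j)].
exists t1, 1; split => //; last by constructor; rewrite /=; constructor.
move=> j; rewrite !ffunE /upd; case: eqP => [->|_]; last exact: stay_stack.
have [l [k [e1 e2]]] := ht i; exists l.+1; rewrite /= e1 e2.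
by case: (S i) => [|a s] /=; [exists k.-1; case: k {e2} | exists k].
Qed.

Definition mpush i a : mach :=
  @Mach bool false (fun q c =>
    if q then (None, act1 i (Some (inl a), Stay) c)
    else (Some true, act1 i (c i, MoveL) c)).

(** All cells left of the head are blank, so the head first moves onto one and then writes the
    symbol there; hence two steps. *)
Lemma exec_push i a S : exec (mpush i a) S 2 (upd S i (a :: S i)).
Proof.
split=> t ht; pose t1 : tapes := [ffun j => write_move (t j)
    (act1 i (scanned (t i), MoveL) [ffun j0 => scanned (t j0)] j)].
pose t2 : tapes := [ffun j => write_move (t1 j)
    (act1 i (Some (inl a), Stay) [ffun j0 => scanned (t1 j0)] j)].
exists t2, 2; split => //; last first.
  constructor; rewrite /= !ffunE -/t1; constructor; exact: mexec_exit.
move=> j; rewrite !ffunE /upd; case: (eqVneq j i) => [->|_]; last first.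
  by apply: stay_stack; apply: stay_stack.
have es := scanned_stack (ht i).
have [l [k [e1 e2]]] := ht i; rewrite /tape_stack /= e1 e2 es.
exists l.-1; case: (S i) {es e2} => [|b s] /=; last by exists k; case: l {e1}.
by exists k.-1.+1; case: k => [|k]; case: l {e1}.
Qed.

Definition mseq (M1 M2 : mach) : mach :=
  @Mach (mstate M1 + mstate M2)%type (inl (mstart M1)) (fun q c =>
    match q with
    | inl q1 => let r := mdelta q1 c in
        (Some (if r.1 is Some q' then inl q' else inr (mstart M2)), r.2)
    | inr q2 => let r := mdelta q2 c in (omap inr r.1, r.2)
    end).

(** The last transition of [M1] already enters the start state of [M2], so the bounds add up without
    overhead. *)
Lemma exec_seq M1 M2 S b1 S1 b2 S2 :
  exec M1 S b1 S1 -> exec M2 S1 b2 S2 -> exec (mseq M1 M2) S (b1 + b2) S2.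
Proof.
move=> [H1] [H2]; split=> t /H1 [t1 [n1 [le1 /H2 [t2 [n2 [le2 ht2 ev2]]] ev1]]].
exists t2, (n1 + n2); split; [exact: leq_add | exact: ht2 |].
have lift2 q : mexec M2 q t1 n2 t2 -> mexec (mseq M1 M2) (omap inr q) t1 n2 t2.
  elim=> [u|q' u n u' _ IH] /=; first exact: mexec_exit.
  by apply: mexec_step; rewrite /=.
have {lift2}ev2 := lift2 _ ev2.
suff {H1 H2 le1}: forall q, mexec M1 q t n1 t1 ->
    mexec (mseq M1 M2) (Some (if q is Some q' then inl q' else inr (mstart M2)))
      t (n1 + n2) t2 by move=> /(_ _ ev1).
move=> q {ev1} ev1; elim: ev1 ev2 => [u|q' u n u' _ IH] //= ev2.
by rewrite addSn; apply: mexec_step => /=; apply: IH.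
Qed.

Definition csym (x : cell) : option symbol := if x is Some (inl a) then Some a else None.

Definition mif i (c : pred (option symbol)) (M1 M2 : mach) : mach :=
  @Mach (option (mstate M1 + mstate M2)) None (fun q x =>
    match q with
    | None => (Some (Some (if c (csym (x i)) then inl (mstart M1) else inr (mstart M2))),
               act1 i (x i, Stay) x)
    | Some (inl q1) => let r := mdelta q1 x in (omap (Some \o inl) r.1, r.2)
    | Some (inr q2) => let r := mdelta q2 x in (omap (Some \o inr) r.1, r.2)
    end).

Lemma csym_stack (t : tapes) S i : holds t S -> csym (scanned (t i)) = ohead (S i).
Proof. by move=> /(_ i) /scanned_stack ->; case: (S i). Qed.

Lemma idle_holds (t : tapes) S i : holds t S ->
  holds [ffun j => write_move (t j)
    (act1 i (scanned (t i), Stay) [ffun j0 => scanned (t j0)] j)] S.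
Proof.
by move=> ht j; rewrite !ffunE; case: eqP => [->|_]; apply: stay_stack.
Qed.

Lemma exec_if i (c : pred (option symbol)) M1 M2 S b S' :
  (if c (ohead (S i)) then exec M1 S b S' else exec M2 S b S') ->
  exec (mif i c M1 M2) S b.+1 S'.
Proof.
move=> H; split=> t ht; have ht1 := idle_holds i ht; move: ht1 H.
set t1 := [ffun j => _] => ht1.
case: ifP => cS H; have [t' [n [le ht' ev]]] := exec_run H ht1; exists t', n.+1; split => //;
  apply: mexec_step; rewrite /= !ffunE (csym_stack i ht) cS -/t1;
  [suff : forall q, mexec M1 q t1 n t' ->
      mexec (mif i c M1 M2) (omap (Some \o inl) q) t1 n t' by move=> /(_ _ ev)
  |suff : forall q, mexec M2 q t1 n t' ->
      mexec (mif i c M1 M2) (omap (Some \o inr) q) t1 n t' by move=> /(_ _ ev)];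
  move=> q; elim=> [u|q' u m u' _ IH] /=; try exact: mexec_exit;
  by apply: mexec_step.
Qed.

Definition mwhile i (c : pred (option symbol)) (M : mach) : mach :=
  @Mach (option (mstate M)) None (fun q x =>
    match q with
    | None => (if c (csym (x i)) then Some (Some (mstart M)) else None,
               act1 i (x i, Stay) x)
    | Some q1 => let r := mdelta q1 x in (Some r.1, r.2)
    end).

Lemma exec_while_stop i (c : pred (option symbol)) M S :
  ~~ c (ohead (S i)) -> exec (mwhile i c M) S 1 S.
Proof.
move=> cS; split=> t ht; have := idle_holds i ht.
set t1 := [ffun j => _] => ht1; exists t1, 1; split=> //.
apply: mexec_step; rewrite /= !ffunE (csym_stack i ht) (negbTE cS); exact: mexec_exit.
Qed.

Lemma exec_while_step i (c : pred (option symbol)) M S b1 S1 b2 S2 :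
  c (ohead (S i)) -> exec M S b1 S1 -> exec (mwhile i c M) S1 b2 S2 ->
  exec (mwhile i c M) S (b1 + b2).+1 S2.
Proof.
move=> cS [H1] [H2]; split=> t ht; have /H1 [t1 [n1 [le1 /H2 [t2 [n2 [le2 ht2 ev2]]] ev1]]]
  := idle_holds i ht.
exists t2, (n1 + n2).+1; split=> //; first by rewrite ltnS leq_add.
apply: mexec_step; rewrite /= !ffunE (csym_stack i ht) cS; move: ev1.
set t0 := [ffun j => _] => ev1.
suff : forall q, mexec M q t0 n1 t1 -> mexec (mwhile i c M) (Some q) t0 (n1 + n2) t2
  by move=> /(_ _ ev1).
move=> q {}ev1; elim: ev1 ev2 => [u|q' u n u' _ IH] //= ev2.
by rewrite addSn; apply: mexec_step => /=; apply: IH.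
Qed.

(** * Trees on the main stack *)

Inductive tree := Leaf of bool | Node of seq tree.

Definition kids (t : tree) : seq tree := if t is Node l then l else [::].

Notation LB := (inr true : symbol).
Notation RB := (inr false : symbol).

Fixpoint enc (t : tree) : seq symbol :=
  match t with
  | Leaf b => [:: inl b]
  | Node l => LB :: flatten (map enc l) ++ [:: RB]
  end.

Definition encs (l : seq tree) : seq symbol := flatten (map enc l).

Notation sz t := (size (enc t)).

Lemma encs_cons t l : encs (t :: l) = enc t ++ encs l.
Proof. by []. Qed.

Lemma encN l : enc (Node l) = LB :: encs l ++ [:: RB].
Proof. by []. Qed.

Lemma encs_cat l1 l2 : encs (l1 ++ l2) = encs l1 ++ encs l2.
Proof. by rewrite /encs map_cat flatten_cat. Qed.

Lemma tree_rect_seq (P : tree -> Prop) :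
  (forall b, P (Leaf b)) ->
  (forall l, List.Forall P l -> P (Node l)) -> forall t, P t.
Proof.
move=> HL HN; fix IH 1; case=> [b|l]; first exact: HL.
apply: HN; elim: l => [|t l IHl]; constructor; [exact: IH | exact: IHl].
Qed.

Definition i0 : 'I_4 := @Ordinal 4 0 isT.
Definition i1 : 'I_4 := @Ordinal 4 1 isT.
Definition i2 : 'I_4 := @Ordinal 4 2 isT.
Definition i3 : 'I_4 := @Ordinal 4 3 isT.

Definition mvsym i j : mach :=
  foldr (fun a M => mif i (pred1 (Some a)) (mseq (mpop i) (mpush j a)) M) (mpop i)
    [:: inl true; inl false; LB; RB].

(** At most four tests identify the symbol; the pop then costs one step and the push two. *)
Lemma exec_mvsym i j a s S : i != j -> S i = a :: s ->
  exec (mvsym i j) S 7 (upd (upd S i s) j (a :: S j)).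
Proof.
move=> ij Si.
have H : exec (mseq (mpop i) (mpush j a)) S (1 + 2) (upd (upd S i s) j (a :: S j)).
  apply: exec_seq; first exact: exec_pop.
  apply: (exec_ext (exec_push j a _)) => // k.
  by rewrite /upd Si /= (eq_sym j i) (negbTE ij).
rewrite /mvsym /=; case: a H Si => [[]|[]] H Si;
  do ![apply: exec_if; rewrite Si [ohead _]/= /=]; exact: exec_ext H _ _ _.
Qed.

Definition mvall i j := mwhile i isSome (mvsym i j).

Lemma exec_mvall i j S : i != j ->
  exec (mvall i j) S (8 * size (S i) + 1) (upd (upd S i [::]) j (catrev (S i) (S j))).
Proof.
move=> ij; move e: (S i) => w; elim: w S e => [|a w IH] S e.
  have H : ~~ isSome (ohead (S i)) by rewrite e.
  apply: exec_ext (exec_while_stop _ H) _ _ _ => //.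
  by move=> k; rewrite /upd; case: eqP => [->|_] //; case: eqP => [->|].
have := exec_mvsym ij e; set S1 := upd _ _ _ => H1.
have e1 : S1 i = w by rewrite /S1 /upd (negbTE ij) eqxx.
have cS : isSome (ohead (S i)) by rewrite e.
have H := exec_while_step cS H1 (IH _ e1).
apply: exec_ext H _ _ _ => //; last by rewrite /=; lia.
move=> k; rewrite /S1 /upd eqxx /=; case: eqP => // _; by case: eqP.
Qed.

Definition mclear i := mwhile i isSome (mpop i).

Lemma exec_clear i S : exec (mclear i) S (2 * size (S i) + 1) (upd S i [::]).
Proof.
move e: (S i) => w; elim: w S e => [|a w IH] S e.
  have H : ~~ isSome (ohead (S i)) by rewrite e.
  apply: exec_ext (exec_while_stop _ H) _ _ _ => //.
  by move=> k; rewrite /upd; case: eqP => [->|_].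
have := exec_pop i S; set S1 := upd _ _ _ => H1.
have e1 : S1 i = w by rewrite /S1 /upd eqxx e.
have cS : isSome (ohead (S i)) by rewrite e.
have H := exec_while_step cS H1 (IH _ e1).
apply: exec_ext H _ _ _ => //; last by rewrite /=; lia.
by move=> k; rewrite /S1 /upd; case: eqP.
Qed.

Definition mskip := mwhile i3 pred0 (mpop i3).

(* Tape 3 holds the current bracket depth in unary. *)
Definition mvstep i j : mach :=
  mseq (mif i (pred1 (Some LB)) (mpush i3 LB)
         (mif i (pred1 (Some RB)) (mpop i3) mskip))
       (mvsym i j).

(** The depth is zero at the beginning as well as at the end, so one symbol is moved before the loop
    starts. A leaf leaves the depth at zero and the loop stops at once. *)
Definition mvtree i j : mach := mseq (mvstep i j) (mwhile i3 isSome (mvstep i j)).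

Section MoveTree.
Variables (i j : 'I_4) (ij : i != j) (ni : i != i3) (nj : j != i3) (S : stacks).

Let cf u v d : stacks :=
  fun k => if k == j then v else if k == i then u else if k == i3 then d else S k.

Let depth (a : symbol) (d : seq symbol) : seq symbol :=
  match a with inl _ => d | inr true => LB :: d | inr false => behead d end.

Let exec_mvstep a u v d : exec (mvstep i j) (cf (a :: u) v d) 11 (cf u (a :: v) (depth a d)).
Proof.
have cfi x y z : cf x y z i = x by rewrite /cf (negbTE ij) eqxx.
have cfj x y z : cf x y z j = y by rewrite /cf eqxx.
have cf3 x y z : cf x y z i3 = z.
  by rewrite /cf !(eq_sym i3) (negbTE ni) (negbTE nj) eqxx.
have H : exec (mif i (pred1 (Some LB)) (mpush i3 LB)
         (mif i (pred1 (Some RB)) (mpop i3) mskip)) (cf (a :: u) v d) 4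
         (cf (a :: u) v (depth a d)).
  case: a => [b|[]].
  - apply: exec_ext (exec_if (b := 2) _) _ _ _ => //; rewrite cfi /=.
    by apply: exec_if; rewrite cfi /=; apply: exec_while_stop.
  - apply: exec_ext (exec_if (b := 2) _) _ _ _ => //; rewrite cfi /=.
    apply: exec_ext (exec_push _ _ _) _ _ _ => // k; rewrite cf3 /upd /cf /=.
    by case: (k =P i3) => [->|//]; rewrite !(eq_sym i3) (negbTE ni) (negbTE nj).
  - apply: exec_ext (exec_if (b := 2) _) _ _ _ => //; rewrite cfi /=.
    apply: exec_if; rewrite cfi /=.
    apply: exec_ext (exec_pop _ _) _ _ _ => // k; rewrite cf3 /upd /cf /=.
    by case: (k =P i3) => [->|//]; rewrite !(eq_sym i3) (negbTE ni) (negbTE nj).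
apply: exec_ext (exec_seq H (exec_mvsym ij (cfi _ _ _))) _ _ _ => // k.
by rewrite cfj /upd /cf; case: eqP => // _; case: eqP.
Qed.

Let loop := mwhile i3 isSome (mvstep i j).

Let loop_step a u v d b S' : d != [::] ->
  exec loop (cf u (a :: v) (depth a d)) b S' -> exec loop (cf (a :: u) v d) (12 + b) S'.
Proof.
move=> dn H; apply: exec_ext (exec_while_step _ (exec_mvstep a u v d) H) _ _ _ => //.
by rewrite /cf !(eq_sym i3) (negbTE ni) (negbTE nj) eqxx; case: d dn {H}.
Qed.

(** Starting at positive depth, the loop cannot stop inside a tree, nor right after it. The rest of
    the run appears as a hypothesis, so that the trees of a list can be chained. *)
Let loop_tree t : forall u v d b S', d != [::] ->
  exec loop (cf u (catrev (enc t) v) d) b S' ->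
  exec loop (cf (enc t ++ u) v d) (12 * sz t + b) S'.
Proof.
elim/tree_rect_seq: t => [c|l IH] u v d b S' dn H; first exact: loop_step.
have {IH} IH : forall u v d b S', d != [::] ->
    exec loop (cf u (catrev (encs l) v) d) b S' ->
    exec loop (cf (encs l ++ u) v d) (12 * size (encs l) + b) S'.
  elim: IH => [|t l' IHt _ IHl] {H}u {}v {dn}d {}b {}S' dn H //.
  rewrite encs_cons -catA size_cat mulnDr -addnA; apply: IHt => //; apply: IHl => //.
  by move: H; rewrite encs_cons !catrevE rev_cat -catA.
rewrite encN; have -> : 12 * size (LB :: encs l ++ [:: RB]) + b =
    12 + (12 * size (encs l) + (12 + b)) by rewrite /= size_cat /=; lia.
rewrite cat_cons -catA; apply: (@loop_step LB) => //.
apply: IH => //; apply: (@loop_step RB) => //=.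
by move: H; rewrite encN /= catrev_catl.
Qed.

Lemma exec_mvtree_aux t u v :
  exec (mvtree i j) (cf (enc t ++ u) v [::]) (12 * sz t + 1) (cf u (catrev (enc t) v) [::]).
Proof.
have stop u' v' : exec loop (cf u' v' [::]) 1 (cf u' v' [::]).
  by apply: exec_while_stop; rewrite /cf !(eq_sym i3) (negbTE ni) (negbTE nj) eqxx.
case: t => [b|l].
  by apply: (exec_ext (exec_seq (exec_mvstep (inl b) u v [::]) (stop _ _))).
suff H : exec loop (cf (encs l ++ RB :: u) (LB :: v) [:: LB])
    (12 * size (encs l) + (12 + 1)) (cf u (catrev (enc (Node l)) v) [::]).
  have := exec_seq (exec_mvstep LB (encs l ++ RB :: u) v [::]) H.
  move=> {}H; apply: (exec_ext H) => //; last by rewrite encN /= size_cat /=; lia.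
  by move=> k; rewrite encN /= -catA.
rewrite encN /= catrev_catl /=.
elim: l (LB :: v) => [|t l IH] v' /=.
  by apply: (loop_step (a := RB)) => //=; apply: stop.
rewrite encs_cons -catA size_cat mulnDr -addnA; apply: loop_tree => //.
by rewrite !catrevE rev_cat -!catA; have := IH (rev (enc t) ++ v'); rewrite !catrevE.
Qed.
End MoveTree.

Lemma exec_mvtree i j S t u : i != j -> i != i3 -> j != i3 ->
  S i = enc t ++ u -> S i3 = [::] ->
  exec (mvtree i j) S (12 * sz t + 1) (upd (upd S i u) j (catrev (enc t) (S j))).
Proof.
move=> ij ni nj Si S3.
apply: exec_ext (exec_mvtree_aux ij ni nj S t u (S j)) _ _ (leqnn _) => k.
  by case: eqP => [->|_] //; case: eqP => [->|_] //; case: eqP => [->|].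
rewrite /upd; case: eqP => // _; case: eqP => // _; by case: eqP => [->|].
Qed.

(** The main stack and two buffers. The default of [nth] makes the depth tape empty, as it is before
    and after every program. *)
Definition stk (m a b : seq symbol) : stacks := fun k => nth [::] [:: m; a; b] k.

Ltac stk_ext := move=> [[|[|[|[|?]]]] ?] //=.

Lemma push0 x m a b : exec (mpush i0 x) (stk m a b) 2 (stk (x :: m) a b).
Proof. by apply: (exec_ext (exec_push i0 x (stk m a b))) => //; stk_ext. Qed.

Lemma push2 x m a b : exec (mpush i2 x) (stk m a b) 2 (stk m a (x :: b)).
Proof. by apply: (exec_ext (exec_push i2 x (stk m a b))) => //; stk_ext. Qed.

Lemma pop0 x m a b : exec (mpop i0) (stk (x :: m) a b) 1 (stk m a b).
Proof. by apply: (exec_ext (exec_pop i0 (stk (x :: m) a b))) => //; stk_ext. Qed.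

Lemma pop1 x m a b : exec (mpop i1) (stk m (x :: a) b) 1 (stk m a b).
Proof. by apply: (exec_ext (exec_pop i1 (stk m (x :: a) b))) => //; stk_ext. Qed.

Lemma mvtree01 t m a b :
  exec (mvtree i0 i1) (stk (enc t ++ m) a b) (12 * sz t + 1) (stk m (catrev (enc t) a) b).
Proof.
by apply: (exec_ext (exec_mvtree (S := stk (enc t ++ m) a b) (t := t) (u := m) _ _ _ _ _));
  rewrite //; stk_ext.
Qed.

Lemma mvtree02 t m a b :
  exec (mvtree i0 i2) (stk (enc t ++ m) a b) (12 * sz t + 1) (stk m a (catrev (enc t) b)).
Proof.
by apply: (exec_ext (exec_mvtree (S := stk (enc t ++ m) a b) (t := t) (u := m) _ _ _ _ _));
  rewrite //; stk_ext.
Qed.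

Lemma mvall10 m a b :
  exec (mvall i1 i0) (stk m a b) (8 * size a + 1) (stk (catrev a m) [::] b).
Proof. by apply: (exec_ext (exec_mvall (stk m a b) _)) => //; stk_ext. Qed.

Lemma mvall20 m a b :
  exec (mvall i2 i0) (stk m a b) (8 * size b + 1) (stk (catrev b m) a [::]).
Proof. by apply: (exec_ext (exec_mvall (stk m a b) _)) => //; stk_ext. Qed.

Lemma mvall21 m a b :
  exec (mvall i2 i1) (stk m a b) (8 * size b + 1) (stk m (catrev b a) [::]).
Proof. by apply: (exec_ext (exec_mvall (stk m a b) _)) => //; stk_ext. Qed.

Lemma clear1 m a b : exec (mclear i1) (stk m a b) (2 * size a + 1) (stk m [::] b).
Proof. by apply: (exec_ext (exec_clear i1 (stk m a b))) => //; stk_ext. Qed.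

(** A word arrives in a buffer reversed; moving the buffer back restores its order. *)
Lemma catrev2 (T : Type) (w v m : seq T) : catrev (catrev w v) m = catrev v (w ++ m).
Proof. by elim: w v => //= a w IH v; rewrite IH. Qed.

Lemma size_catrev (T : Type) (w v : seq T) : size (catrev w v) = size w + size v.
Proof. by rewrite catrevE size_cat size_rev. Qed.

Lemma exec_seq_eq M1 M2 S b1 S1 b2 S2 S3 b :
  exec M1 S b1 S1 -> exec M2 S1 b2 S2 -> S2 = S3 -> b1 + b2 <= b ->
  exec (mseq M1 M2) S b S3.
Proof. by move=> H1 H2 <- le; apply: (exec_ext (exec_seq H1 H2)). Qed.

Lemma exec_ifT i (c : pred (option symbol)) M1 M2 S b S' :
  c (ohead (S i)) -> exec M1 S b S' -> exec (mif i c M1 M2) S b.+1 S'.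
Proof. by move=> cS H; apply: exec_if; rewrite cS. Qed.

Lemma exec_ifF i (c : pred (option symbol)) M1 M2 S b S' :
  ~~ c (ohead (S i)) -> exec M2 S b S' -> exec (mif i c M1 M2) S b.+1 S'.
Proof. by move=> cS H; apply: exec_if; rewrite (negbTE cS). Qed.

Definition mdrop := mseq (mvtree i0 i1) (mclear i1).

Lemma exec_drop t m : exec mdrop (stk (enc t ++ m) [::] [::]) (14 * sz t + 2) (stk m [::] [::]).
Proof.
apply: exec_seq_eq (mvtree01 _ _ _ _) (clear1 _ _ _) _ _ => //.
by rewrite size_catrev /=; lia.
Qed.

Definition mswap :=
  mseq (mvtree i0 i1) (mseq (mvtree i0 i2) (mseq (mvall i1 i0) (mvall i2 i0))).

Lemma exec_swap t u m : exec mswap (stk (enc t ++ enc u ++ m) [::] [::])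
  (20 * (sz t + sz u) + 4) (stk (enc u ++ enc t ++ m) [::] [::]).
Proof.
apply: exec_seq_eq (mvtree01 _ _ _ _) (exec_seq (mvtree02 _ _ _ _)
   (exec_seq (mvall10 _ _ _) (mvall20 _ _ _))) _ _; first by rewrite !catrev2.
by rewrite !size_catrev /=; lia.
Qed.

Definition mcopy : mach :=
  foldr (fun a M => mif i1 (pred1 (Some a))
    (mseq (mpop i1) (mseq (mpush i0 a) (mpush i2 a))) M) (mpop i1)
    [:: inl true; inl false; LB; RB].

Lemma exec_copy x m a b : exec mcopy (stk m (x :: a) b) 9 (stk (x :: m) a (x :: b)).
Proof.
have H : exec (mseq (mpop i1) (mseq (mpush i0 x) (mpush i2 x))) (stk m (x :: a) b) 5
    (stk (x :: m) a (x :: b)).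
  exact: exec_seq_eq (pop1 _ _ _ _) (exec_seq (push0 _ _ _ _) (push2 _ _ _ _)) erefl _.
rewrite /mcopy /=; case: x H => [[]|[]] H;
  do ![apply: exec_if; rewrite [ohead _]/= /=]; exact: exec_ext H _ _ _.
Qed.

Definition mdup :=
  mseq (mvtree i0 i1) (mseq (mwhile i1 isSome mcopy) (mseq (mvall i2 i1) (mvall i1 i0))).

Lemma exec_dup t m : exec mdup (stk (enc t ++ m) [::] [::]) (40 * sz t + 4)
  (stk (enc t ++ enc t ++ m) [::] [::]).
Proof.
have H a m' b : exec (mwhile i1 isSome mcopy) (stk m' a b) (10 * size a + 1)
    (stk (catrev a m') [::] (catrev a b)).
  elim: a m' b => [|x a IH] m' b; first exact: exec_while_stop.
  apply: (exec_ext (exec_while_step _ (exec_copy _ _ _ _) (IH _ _))) => //=; lia.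
apply: exec_seq_eq (mvtree01 _ _ _ _) (exec_seq (H _ _ _)
   (exec_seq (mvall21 _ _ _) (mvall10 _ _ _))) _ _; rewrite !catrev2 //= ?cats0 //.
by rewrite !size_catrev /= ; lia.
Qed.

(** * Polynomial bounds and the class of polynomial-time tree functions *)

Lemma poly_weaken n c d : c <= d -> (n + 2) ^ c <= (n + 2) ^ d.
Proof. by move=> le; rewrite leq_exp2l // addn2. Qed.

(** The base is at least 2, so constants and sums are absorbed by a larger exponent. *)
Definition poly (p : nat -> nat) := exists c, forall n, p n <= (n + 2) ^ c.

Lemma poly_const k : poly (fun=> k).
Proof.
exists k => n; apply: (@leq_trans (2 ^ k)); first exact/ltnW/ltn_expl.
by case: k => // k; rewrite leq_exp2r // leq_addl.
Qed.

Lemma poly_id : poly id.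
Proof. by exists 1 => n; rewrite expn1 leq_addr. Qed.

Lemma polyM p q : poly p -> poly q -> poly (fun n => p n * q n).
Proof. by move=> [c Hc] [d Hd]; exists (c + d) => n; rewrite expnD leq_mul. Qed.

Lemma polyD p q : poly p -> poly q -> poly (fun n => p n + q n).
Proof.
move=> [c Hc] [d Hd]; exists (maxn c d).+1 => n; rewrite expnS.
apply: leq_trans (leq_mul (leq_addl n 2) (leqnn _)); rewrite mul2n -addnn.
by apply: leq_add; [apply: leq_trans (Hc n) _|apply: leq_trans (Hd n) _];
  apply: poly_weaken; rewrite ?leq_maxl ?leq_maxr.
Qed.

Lemma polyX p k : poly p -> poly (fun n => p n ^ k).
Proof.
move=> [c Hc]; exists (c * k) => n; rewrite expnM.
by case: k => // k; rewrite leq_exp2r.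
Qed.

Lemma poly_le p q : poly q -> (forall n, p n <= q n) -> poly p.
Proof. by move=> [c Hc] le; exists c => n; apply: leq_trans (Hc n). Qed.

Ltac poly_tac := repeat first
  [ apply: poly_const | apply: poly_id | apply: polyD | apply: polyM | apply: polyX ].

(* [f] is evaluated in place on top of the main stack, the rest of which is
   never inspected; the size bound makes the class closed under composition. *)
Definition ptime (f : tree -> tree) : Prop := exists M p,
  [/\ poly p, forall x, sz (f x) <= p (sz x)
    & forall x m, exec M (stk (enc x ++ m) [::] [::]) (p (sz x))
                         (stk (enc (f x) ++ m) [::] [::])].

(** The bound holds for every upper estimate [k] of the input size, not only for the size itself;
    this is what composition needs, where the size of the intermediate tree is merely estimated. *)
Lemma ptimeE f : ptime f -> exists M c,
  [/\ forall x k, sz x <= k -> sz (f x) <= (k + 2) ^ c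
    & forall x m k, sz x <= k ->
      exec M (stk (enc x ++ m) [::] [::]) ((k + 2) ^ c) (stk (enc (f x) ++ m) [::] [::])].
Proof.
move=> [M [p [[c Hc] Hs He]]]; exists M, c.
have le x k : sz x <= k -> p (sz x) <= (k + 2) ^ c.
  move=> le; apply: leq_trans (Hc _) _; case: (c) => // c'.
  by rewrite leq_exp2r // leq_add2r.
split=> [x k /le|x m k /le]; first exact: leq_trans (Hs x).
by move=> lek; apply: (exec_ext (He x m)).
Qed.

Lemma eq_ptime f g : f =1 g -> ptime f -> ptime g.
Proof. by move=> e [M [p [pp Hs He]]]; exists M, p; split=> // *; rewrite -e. Qed.

Lemma ptime_id : ptime id.
Proof.
exists mskip, (fun n => n + 1); split=> [|x|x m]; first by poly_tac.
- exact: leq_addr.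
- by apply: (exec_ext (exec_while_stop _ _)) => //; rewrite leq_addl.
Qed.

Lemma ptime_comp g f : ptime g -> ptime f -> ptime (fun x => g (f x)).
Proof.
move=> /ptimeE [Mg [c [sg eg]]] /ptimeE [Mf [d [sf ef]]].
exists (mseq Mf Mg), (fun n => (n + 2) ^ d + ((n + 2) ^ d + 2) ^ c); split=> [|x|x m].
- by poly_tac.
- by apply: leq_trans (sg _ _ (sf x _ (leqnn _))) _; rewrite leq_addl.
- exact: exec_seq (ef _ _ _ (leqnn _)) (eg _ _ _ (sf _ _ (leqnn _))).
Qed.

Lemma ptime_const t : ptime (fun=> t).
Proof.
pose P w := foldr (fun a M => mseq M (mpush i0 a)) mskip w.
have HP w m : exec (P w) (stk m [::] [::]) (2 * size w + 1) (stk (w ++ m) [::] [::]).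
  elim: w => [|a w IH]; first exact: exec_while_stop.
  by apply: exec_seq_eq IH (push0 _ _ _ _) erefl _ => /=; lia.
exists (mseq mdrop (P (enc t))), (fun n => 14 * n + (2 + (2 * sz t + 1))).
split=> [|x|x m]; [by poly_tac | lia |].
by apply: exec_seq_eq (exec_drop _ _) (HP _ _) erefl _; lia.
Qed.

(** Evaluation in place destroys the argument, so it is duplicated first; after [f] has run, a swap
    brings the second copy to the top for [g]. *)
Lemma ptime_fork f g : ptime f -> ptime g -> exists M c,
  [/\ forall x, sz (f x) <= (sz x + 2) ^ c, forall x, sz (g x) <= (sz x + 2) ^ c
    & forall x m, exec M (stk (enc x ++ m) [::] [::]) ((sz x + 2) ^ c)
        (stk (enc (g x) ++ enc (f x) ++ m) [::] [::])].
Proof.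
move=> /ptimeE [Mf [c [sf ef]]] /ptimeE [Mg [d [sg eg]]].
have [e He] : poly (fun n => 40 * n + 4 + ((n + 2) ^ c + (20 * ((n + 2) ^ c + n) + 4
    + (n + 2) ^ d))) by poly_tac.
exists (mseq mdup (mseq Mf (mseq mswap Mg))), e; split=> [x|x|x m].
- by apply: leq_trans (sf x _ (leqnn _)) _; apply: leq_trans (He _); lia.
- by apply: leq_trans (sg x _ (leqnn _)) _; apply: leq_trans (He _); lia.
- apply: exec_seq_eq (exec_dup _ _) (exec_seq (ef _ _ _ (leqnn _)) (exec_seq
    (exec_swap _ _ _) (eg _ _ _ (leqnn _)))) erefl _.
  apply: leq_trans (He _); have := sf x _ (leqnn _); lia.
Qed.

(** * Lists, conditionals and folds on the stack *)

Definition tcons x t := Node (x :: kids t).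
Definition thd t := head (Node [::]) (kids t).
Definition ttl t := Node (behead (kids t)).

(** The tree [t] lies reversed in the first buffer, with its last symbol on top: a closing bracket
    exactly if [t] is a node. Then its opening bracket is removed and a new one is put in front of
    [x]. A leaf is treated as the empty list. *)
Definition mcons := mseq (mvtree i0 i1) (mseq (mvtree i0 i2)
  (mif i1 (pred1 (Some RB))
    (mseq (mvall i1 i0) (mseq (mpop i0) (mseq (mvall i2 i0) (mpush i0 LB))))
    (mseq (mpop i1) (mseq (mpush i0 RB) (mseq (mvall i2 i0) (mpush i0 LB)))))).

Lemma exec_cons x t m : exec mcons (stk (enc t ++ enc x ++ m) [::] [::])
  (20 * (sz x + sz t) + 10) (stk (enc (tcons x t) ++ m) [::] [::]).
Proof.
case: t => [b|l].
  have cS : ~~ pred1 (Some RB) (ohead (stk m [:: inl b] (catrev (enc x) [::]) i1)) by [].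
  have H := exec_seq (mvtree02 x m [:: inl b] [::]) (exec_ifF _ cS
    (exec_seq (pop1 _ _ _ _) (exec_seq (push0 _ _ _ _) (exec_seq (mvall20 _ _ _)
    (push0 _ _ _ _))))).
  apply: (exec_seq_eq (mvtree01 (Leaf b) (enc x ++ m) [::] [::]) (H _ _ _)).
    by rewrite !catrev2 /= cats0 -catA.
  by rewrite !size_catrev /=; lia.
have H := mvall10 m (catrev (enc (Node l)) [::]) (catrev (enc x) [::]).
rewrite catrev2 {3}encN [catrev [::] _]/= -/(encs l) in H.
have cS : pred1 (Some RB) (ohead (stk m (catrev (enc (Node l)) [::])
  (catrev (enc x) [::]) i1)) by rewrite /stk /= -/(encs l) catrev_catl.
apply: exec_seq_eq (mvtree01 _ _ _ _) (exec_seq (mvtree02 _ _ _ _) (exec_ifT _ cS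
  (exec_seq H (exec_seq (pop0 _ _ _ _) (exec_seq (mvall20 _ _ _) (push0 _ _ _ _))))))
  _ _; first by rewrite !catrev2 /= -/(encs l) -!catA.
by rewrite !size_catrev /= /encs !size_cat /=; lia.
Qed.

Lemma sz_cons x t : sz (tcons x t) <= sz x + sz t + 2.
Proof. by case: t => [b|l]; rewrite /= !size_cat /= ?size_cat /=; lia. Qed.

Lemma ptime_cons f g : ptime f -> ptime g -> ptime (fun x => tcons (f x) (g x)).
Proof.
move=> pf pg; have [M [c [sf sg eM]]] := ptime_fork pf pg.
exists (mseq M mcons), (fun n => (n + 2) ^ c + (20 * ((n + 2) ^ c + (n + 2) ^ c) + 10)).
split=> [|x|x m]; first by poly_tac.
- have := sz_cons (f x) (g x); have := sf x; have := sg x; lia.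
- apply: exec_seq_eq (eM _ _) (exec_cons _ _ _) erefl _.
  have := sf x; have := sg x; lia.
Qed.

Lemma clear2 m a b : exec (mclear i2) (stk m a b) (2 * size b + 1) (stk m a [::]).
Proof. by apply: (exec_ext (exec_clear i2 (stk m a b))) => //; stk_ext. Qed.

Lemma enc_notRB t m a b : Some RB != ohead (stk (enc t ++ m) a b i0).
Proof. by case: t. Qed.

Lemma sz_gt0 t : 0 < sz t. Proof. by case: t. Qed.

Lemma szN l : sz (Node l) = size (encs l) + 2.
Proof. by rewrite encN /= size_cat addn1 addn2. Qed.

Lemma size_encs_cons t l : size (encs (t :: l)) = sz t + size (encs l).
Proof. by rewrite encs_cons size_cat. Qed.

Lemma leq_size_encs l : size l <= size (encs l).
Proof.
elim: l => // x l IH; rewrite size_encs_cons [size (x :: l)]/=.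
by have := sz_gt0 x; lia.
Qed.

Definition mnil := mseq (mpop i0) (mseq (mpush i0 RB) (mpush i0 LB)).

Lemma exec_nil x m : exec mnil (stk (x :: m) [::] [::]) 5 (stk (enc (Node [::]) ++ m) [::] [::]).
Proof.
exact: exec_seq_eq (pop0 _ _ _ _) (exec_seq (push0 _ _ _ _) (push0 _ _ _ _)) erefl _.
Qed.

(** Common prologue of head and tail: [M] is run only on a nonempty list whose opening bracket has
    been popped, and in all other cases the result is the empty list. *)
Definition mifnode M := mif i0 (pred1 (Some LB))
  (mseq (mpop i0) (mif i0 (pred1 (Some RB)) (mpush i0 LB) M)) mnil.

Lemma exec_ifnode f M b :
  (forall x l m, exec M (stk (enc x ++ encs l ++ RB :: m) [::] [::]) (b (sz (Node (x :: l))))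
     (stk (enc (f (Node (x :: l))) ++ m) [::] [::])) ->
  f (Node [::]) = Node [::] -> (forall c, f (Leaf c) = Node [::]) ->
  forall x m, exec (mifnode M) (stk (enc x ++ m) [::] [::]) (b (sz x) + 6)
     (stk (enc (f x) ++ m) [::] [::]).
Proof.
move=> H fN fL [c|[|x l]] m.
- have cS : ~~ pred1 (Some LB) (ohead (stk (inl c :: m) [::] [::] i0)) by [].
  by rewrite fL; apply: (exec_ext (exec_ifF _ cS (exec_nil _ _))) => //; lia.
- have cS : pred1 (Some RB) (ohead (stk (RB :: m) [::] [::] i0)) by [].
  have K := exec_ifT M cS (push0 LB (RB :: m) [::] [::]).
  have cS' : pred1 (Some LB) (ohead (stk [:: LB, RB & m] [::] [::] i0)) by [].
  rewrite fN; apply: (exec_ext (exec_ifT _ cS' (exec_seq (pop0 LB _ _ _) K))) => //; lia.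
- have cS : ~~ pred1 (Some RB) (ohead (stk (enc x ++ encs l ++ RB :: m) [::] [::] i0)).
    by rewrite /= eq_sym enc_notRB.
  have K := exec_ifF (mpush i0 LB) cS (H x l m).
  have cS' : pred1 (Some LB) (ohead (stk (LB :: enc x ++ encs l ++ RB :: m) [::] [::] i0)).
    by [].
  apply: (exec_ext (exec_ifT _ cS' (exec_seq (pop0 LB _ _ _) K))) => //; last by lia.
  by move=> k; rewrite /stk encN encs_cons /= -!catA.
Qed.

Lemma ptime_thd : ptime thd.
Proof.
(* With a fresh opening bracket the remaining items form one tree again, which a single tree move
   takes off the stack. *)
pose M := mseq (mvtree i0 i1) (mseq (mpush i0 LB) (mseq (mvtree i0 i2)
  (mseq (mclear i2) (mvall i1 i0)))).
exists (mifnode M), (fun n => 40 * n + 10 + 6); split=> [|[b|[|t l]]|]; try by [].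
- by poly_tac.
- by rewrite szN size_encs_cons /thd /=; lia.
apply: (@exec_ifnode _ _ (fun n => 40 * n + 10)) => // x l m.
have K := mvtree02 (Node l) m (catrev (enc x) [::]) [::]; rewrite {1}encN cat_cons -catA in K.
apply: exec_seq_eq (mvtree01 _ _ _ _) (exec_seq (push0 _ _ _ _) (exec_seq K
  (exec_seq (clear2 _ _ _) (mvall10 _ _ _)))) _ _; first by rewrite catrev2.
by rewrite !size_catrev !szN size_encs_cons [size [::]]/=; lia.
Qed.

Lemma ptime_ttl : ptime ttl.
Proof.
pose M := mseq (mvtree i0 i1) (mseq (mclear i1) (mpush i0 LB)).
exists (mifnode M), (fun n => 40 * n + 10 + 6); split=> [|[b|[|t l]]|]; try by [].
- by poly_tac.
- by rewrite /ttl [behead _]/= !szN size_encs_cons; lia.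
apply: (@exec_ifnode _ _ (fun n => 40 * n + 10)) => // x l m.
apply: exec_seq_eq (mvtree01 _ _ _ _) (exec_seq (clear1 _ _ _) (push0 LB _ _ _)) _ _.
  by rewrite /ttl encN /= -catA.
by rewrite !size_catrev szN size_encs_cons [size [::]]/=; lia.
Qed.

Definition truth (t : tree) : bool := if t is Leaf b then b else false.

Lemma ptime_ite c f g : ptime c -> ptime f -> ptime g ->
  ptime (fun x => if truth (c x) then f x else g x).
Proof.
move=> pc /ptimeE [Mf [cf [sf ef]]] /ptimeE [Mg [cg [sg eg]]].
have [M [d [sc _ eM]]] := ptime_fork pc ptime_id.
pose N := mseq mswap (mif i0 (pred1 (Some (inl true)))
  (mseq mdrop Mf) (mseq mdrop Mg)).
exists (mseq M N), (fun n => (n + 2) ^ d + (20 * (n + (n + 2) ^ d) + 4 +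
  (14 * (n + 2) ^ d + 2 + (n + 2) ^ cf + (n + 2) ^ cg + 1))); split=> [|x|x m].
- by poly_tac.
- by have := sf x _ (leqnn _); have := sg x _ (leqnn _); case: ifP => _; lia.
have := sc x; have K := exec_swap x (c x) m.
case: ifP => ct.
  have cS : pred1 (Some (inl true)) (ohead (stk (enc (c x) ++ enc x ++ m) [::] [::] i0)).
    by case: (c x) ct => // b /= ->.
  have := exec_ifT (mseq mdrop Mg) cS (exec_seq (exec_drop _ _) (ef x m _ (leqnn _))).
  by move=> H le; apply: exec_seq_eq (eM _ _) (exec_seq K H) erefl _; lia.
have cS : ~~ pred1 (Some (inl true)) (ohead (stk (enc (c x) ++ enc x ++ m) [::] [::] i0)).
  by case: (c x) ct => // b /= ->.
have := exec_ifF (mseq mdrop Mf) cS (exec_seq (exec_drop _ _) (eg x m _ (leqnn _))).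
by move=> H le; apply: exec_seq_eq (eM _ _) (exec_seq K H) erefl _; lia.
Qed.

Definition isnil (t : tree) := nilp (kids t).

Lemma ptime_isnil : ptime (fun t => Leaf (isnil t)).
Proof.
pose T c := mseq mdrop (mpush i0 (inl c)).
have HT c x m : exec (T c) (stk (enc x ++ m) [::] [::]) (14 * sz x + 4)
    (stk (enc (Leaf c) ++ m) [::] [::]).
  by apply: exec_seq_eq (exec_drop _ _) (push0 _ _ _ _) erefl _; lia.
pose M := mif i0 (pred1 (Some LB)) (mseq (mpop i0) (mif i0 (pred1 (Some RB))
   (mseq (mpush i0 LB) (T true)) (mseq (mpush i0 LB) (T false)))) (T true).
exists M, (fun n => 14 * n + 20); split=> [|x|x m]; first by poly_tac.
  by have := sz_gt0 x; rewrite /=; lia.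
case: x => [c|[|x l]].
- have cS : ~~ pred1 (Some LB) (ohead (stk (inl c :: m) [::] [::] i0)) by [].
  by apply: (exec_ext (exec_ifF _ cS (HT true (Leaf c) m))).
- have cS : pred1 (Some RB) (ohead (stk (RB :: m) [::] [::] i0)) by [].
  have cS' : pred1 (Some LB) (ohead (stk [:: LB, RB & m] [::] [::] i0)) by [].
  have K := exec_ifT (mseq (mpush i0 LB) (T false)) cS
    (exec_seq (push0 LB (RB :: m) [::] [::]) (HT true (Node [::]) m)).
  by apply: (exec_ext (exec_ifT _ cS' (exec_seq (pop0 LB _ _ _) K))).
have cS : ~~ pred1 (Some RB) (ohead (stk (enc x ++ encs l ++ RB :: m) [::] [::] i0)).
  by rewrite /= eq_sym enc_notRB.
have K' := HT false (Node (x :: l)) m.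
have eN : enc (Node (x :: l)) ++ m = LB :: enc x ++ encs l ++ RB :: m.
  by rewrite encN encs_cons /= -!catA.
rewrite {1}eN in K'.
have K := exec_ifF (mseq (mpush i0 LB) (T true)) cS (exec_seq (push0 LB _ _ _) K').
rewrite eN; have cS' : pred1 (Some LB)
  (ohead (stk (LB :: enc x ++ encs l ++ RB :: m) [::] [::] i0)) by [].
by apply: (exec_ext (exec_ifT _ cS' (exec_seq (pop0 LB _ _ _) K))) => //; lia.
Qed.

Definition tpair a b := Node [:: a; b].

Lemma enc_pair a b : enc (tpair a b) = LB :: enc a ++ enc b ++ [:: RB].
Proof. by rewrite /= cats0 -catA. Qed.

Lemma sz_pair a b : sz (tpair a b) = sz a + sz b + 2.
Proof. by rewrite enc_pair -cat1s !size_cat [size [:: LB]]/= [size [:: RB]]/=; lia. Qed.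

(** The rest of the list lies above the accumulator without its opening bracket, so that the loop
    sees a closing bracket exactly when no item is left. The bracket is put back to move the rest
    out of the way as one tree; then item and accumulator are enclosed in brackets of their own,
    which gives the argument of the body. *)
Definition foldstep MF :=
  mseq (mvtree i0 i1) (mseq (mpush i0 LB) (mseq (mvtree i0 i2) (mseq (mvtree i0 i1)
  (mseq (mvall i2 i0) (mseq (mpush i0 RB) (mseq (mvall i1 i0) (mseq (mpush i0 LB)
  (mseq MF (mseq mswap (mpop i0)))))))))).

Lemma exec_foldstep MF F bF x l z m :
  (forall m, exec MF (stk (enc (tpair x z) ++ m) [::] [::]) bF
     (stk (enc (F (tpair x z)) ++ m) [::] [::])) ->
  exec (foldstep MF) (stk (encs (x :: l) ++ RB :: enc z ++ m) [::] [::])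
    (40 * (size (encs (x :: l)) + sz z + sz (F (tpair x z)) + 2) + bF + 20)
    (stk (encs l ++ RB :: enc (F (tpair x z)) ++ m) [::] [::]).
Proof.
move=> H.
have K := mvtree02 (Node l) (enc z ++ m) (catrev (enc x) [::]) [::].
rewrite {1}encN cat_cons -catA in K.
have R : exec (mseq MF (mseq mswap (mpop i0))) (stk (LB :: catrev (catrev (enc z)
    (catrev (enc x) [::])) (RB :: catrev (catrev (enc (Node l)) [::]) m)) [::] [::])
    (bF + (20 * (sz (F (tpair x z)) + sz (Node l)) + 4 + 1))
    (stk (encs l ++ RB :: enc (F (tpair x z)) ++ m) [::] [::]).
  have catrev0 (s : seq symbol) : catrev [::] s = s by [].
  rewrite !catrev2 !catrev0.
  have := H (enc (Node l) ++ m); rewrite {1}enc_pair cat_cons -!catA cat1s.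
  move=> {}H; apply: exec_seq_eq H _ erefl (leqnn _).
  have Sw := exec_swap (F (tpair x z)) (Node l) m; rewrite {3}encN cat_cons -catA in Sw.
  exact: exec_seq_eq Sw (pop0 _ _ _ _) _ (leqnn _).
rewrite encs_cons -catA.
apply: exec_seq_eq (mvtree01 _ _ _ _) (exec_seq (push0 _ _ _ _) (exec_seq K
  (exec_seq (mvtree01 _ _ _ _) (exec_seq (mvall20 _ _ _) (exec_seq (push0 _ _ _ _)
  (exec_seq (mvall10 _ _ _) (exec_seq (push0 _ _ _ _) R))))))) erefl _.
by rewrite !size_catrev szN size_encs_cons [size [::]]/=; lia.
Qed.

Section Fold.
Variable F : tree -> tree.
Let step z x := F (tpair x z).

(** Iterating a polynomial-time function may double its argument at each turn, hence the bound
    demanded of every intermediate accumulator. *)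
Lemma ptime_fold Z L p : ptime F -> ptime Z -> ptime L -> poly p ->
  (forall x i, sz (foldl step (Z x) (take i (kids (L x)))) <= p (sz x)) ->
  ptime (fun x => foldl step (Z x) (kids (L x))).
Proof.
move=> /ptimeE [MF [c [_ eF]]] pZ pL [e Pe] bnd.
have [M [d [sZ sL eM]]] := ptime_fork pZ pL.
pose loop := mwhile i0 [pred o | o != Some RB] (foldstep MF).
pose N := mif i0 (pred1 (Some LB)) (mseq (mpop i0) (mseq loop (mpop i0))) (mpop i0).
(* Time of one turn if list and accumulator have size at most [B]: the argument of the body then has
   size at most [B + B + 2], and the loop test adds one step to the 20 of [exec_foldstep]. *)
pose T B := 40 * (B + B + B + 2) + (B + B + 2 + 2) ^ c + 21.
have exec_loop B l z m : size (encs l) <= B ->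
    (forall i, sz (foldl step z (take i l)) <= B) ->
    exec loop (stk (encs l ++ RB :: enc z ++ m) [::] [::]) (size l * T B + 1)
      (stk (RB :: enc (foldl step z l) ++ m) [::] [::]).
  elim: l z => [|x l IH] z lB zB; first exact: exec_while_stop.
  have lB' : size (encs l) <= B by move: lB; rewrite size_encs_cons; lia.
  have IH' := IH (step z x) lB' (fun i => zB i.+1).
  have z0 : sz z <= B := zB 0.
  have z1 : sz (step z x) <= B by have := zB 1; rewrite [take 1 _]/= take0.
  have xz : sz (tpair x z) <= B + B + 2.
    by rewrite sz_pair; move: lB; rewrite size_encs_cons; lia.
  have H := exec_foldstep l m (fun m => eF (tpair x z) m _ xz).
  have cS : [pred o | o != Some RB]
      (ohead (stk (encs (x :: l) ++ RB :: enc z ++ m) [::] [::] i0)).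
    by rewrite /= eq_sym encs_cons -catA enc_notRB.
  apply: (exec_ext (exec_while_step cS H IH')) => //.
  by rewrite -/(step z x) [size (x :: l)]/= mulSn /T; lia.
pose B n := (n + 2) ^ d + (n + 2) ^ e.
exists (mseq M N), (fun n => (n + 2) ^ d + (B n * T (B n) + 10) + (n + 2) ^ e).
split=> [|x|x m].
- by rewrite /T /B; poly_tac.
- have := bnd x (size (kids (L x))); rewrite take_size => le.
  by apply: leq_trans le _; apply: leq_trans (Pe _) _; rewrite leq_addl.
suff K : exec N (stk (enc (L x) ++ enc (Z x) ++ m) [::] [::])
    (B (sz x) * T (B (sz x)) + 10)
    (stk (enc (foldl step (Z x) (kids (L x))) ++ m) [::] [::]).
  by apply: exec_seq_eq (eM _ _) K erefl _; rewrite leq_addr.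
have {}bnd i := leq_trans (bnd x i) (Pe _); have {}sL := sL x.
case: (L x) bnd sL => [b|l] bnd sL.
  have cS : ~~ pred1 (Some LB) (ohead (stk (inl b :: enc (Z x) ++ m) [::] [::] i0)) by [].
  by apply: (exec_ext (exec_ifF _ cS (pop0 _ _ _ _))) => //; lia.
have lB : size (encs l) <= B (sz x) by move: sL; rewrite szN /B; lia.
have zB i : sz (foldl step (Z x) (take i l)) <= B (sz x).
  by apply: leq_trans (bnd i) _; rewrite leq_addl.
have H := exec_loop _ _ _ m lB zB.
have := exec_seq (pop0 LB _ _ _) (exec_seq H (pop0 _ _ _ _)).
set S0 := stk (LB :: _) _ _ => {}H.
have cS : pred1 (Some LB) (ohead (S0 i0)) by [].
apply: (exec_ext (exec_ifT _ cS H)) => //.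
  by move=> k; rewrite /S0 encN /= -catA.
have : size l * T (B (sz x)) <= B (sz x) * T (B (sz x)).
  by rewrite leq_mul2r (leq_trans (leq_size_encs l) lB) orbT.
lia.
Qed.
End Fold.

(** * List programming in polynomial time *)

Lemma ptime_hd f : ptime f -> ptime (fun x => thd (f x)).
Proof. exact: ptime_comp ptime_thd. Qed.

Lemma ptime_tl f : ptime f -> ptime (fun x => ttl (f x)).
Proof. exact: ptime_comp ptime_ttl. Qed.

Lemma ptime_nilb f : ptime f -> ptime (fun x => Leaf (isnil (f x))).
Proof. exact: ptime_comp ptime_isnil. Qed.

Lemma ptime_pair f g : ptime f -> ptime g -> ptime (fun x => tpair (f x) (g x)).
Proof.
move=> pf pg; apply: (ptime_cons pf (g := fun x => tcons (g x) (Node [::]))).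
exact: ptime_cons pg (ptime_const _).
Qed.

Lemma ptime_if (b : tree -> bool) f g : ptime (fun x => Leaf (b x)) -> ptime f -> ptime g ->
  ptime (fun x => if b x then f x else g x).
Proof. exact: ptime_ite. Qed.

Lemma ptime_truth f : ptime f -> ptime (fun x => Leaf (truth (f x))).
Proof.
move=> pf; apply: eq_ptime (ptime_ite pf (ptime_const (Leaf true)) (ptime_const (Leaf false))).
by move=> x; case: truth.
Qed.

Lemma ptime_andb (a b : tree -> bool) : ptime (fun x => Leaf (a x)) ->
  ptime (fun x => Leaf (b x)) -> ptime (fun x => Leaf (a x && b x)).
Proof.
move=> pa pb; apply: eq_ptime (ptime_if pa pb (ptime_const (Leaf false))) => x.
by case: (a x).
Qed.

Lemma ptime_orb (a b : tree -> bool) : ptime (fun x => Leaf (a x)) ->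
  ptime (fun x => Leaf (b x)) -> ptime (fun x => Leaf (a x || b x)).
Proof.
move=> pa pb; apply: eq_ptime (ptime_if pa (ptime_const (Leaf true)) pb) => x.
by case: (a x).
Qed.

Lemma ptime_negb (a : tree -> bool) : ptime (fun x => Leaf (a x)) ->
  ptime (fun x => Leaf (~~ a x)).
Proof.
move=> pa; apply: eq_ptime (ptime_if pa (ptime_const (Leaf false)) (ptime_const (Leaf true))).
by move=> x; case: (a x).
Qed.

Lemma ptime_addb (a b : tree -> bool) : ptime (fun x => Leaf (a x)) ->
  ptime (fun x => Leaf (b x)) -> ptime (fun x => Leaf (a x (+) b x)).
Proof.
move=> pa pb; apply: eq_ptime (ptime_if pa (ptime_negb pb) pb) => x.
by case: (a x).
Qed.

(* The argument [tpair y (tpair x acc)] of a loop body consists of the current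
   list element [y], the environment [x] and the accumulator. *)
Definition penv t := thd (thd (ttl t)).
Definition pelt t := thd t.
Definition pacc t := thd (ttl (thd (ttl t))).

Lemma ptime_penv f : ptime f -> ptime (fun x => penv (f x)).
Proof. by move=> pf; apply: ptime_hd; apply: ptime_hd; apply: ptime_tl. Qed.
Lemma ptime_pelt f : ptime f -> ptime (fun x => pelt (f x)).
Proof. exact: ptime_hd. Qed.
Lemma ptime_pacc f : ptime f -> ptime (fun x => pacc (f x)).
Proof.
by move=> pf; apply: ptime_hd; apply: ptime_tl; apply: ptime_hd; apply: ptime_tl.
Qed.

Notation ptime_body f := (ptime (fun t => f (penv t) (pelt t) (pacc t))).

(** A fold body sees only the item and the accumulator, so the environment travels inside the
    accumulator. *)
Lemma ptime_foldl f A L p : ptime_body f -> ptime A -> ptime L -> poly p ->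
  (forall x i, sz (foldl (fun acc y => f x y acc) (A x) (take i (kids (L x)))) <= p (sz x)) ->
  ptime (fun x => foldl (fun acc y => f x y acc) (A x) (kids (L x))).
Proof.
move=> pf pA pL pp bnd.
pose F t := tpair (penv t) (f (penv t) (pelt t) (pacc t)).
have foldF x a l : foldl (fun z y => F (tpair y z)) (tpair x a) l =
    tpair x (foldl (fun acc y => f x y acc) a l) by elim: l a => //= y l IH a; apply: IH.
have := @ptime_fold F (fun x => tpair x (A x)) L (fun n => n + p n + 2).
move=> /(_ (ptime_pair (ptime_penv ptime_id) pf) (ptime_pair ptime_id pA) pL) H.
have {}H := H (polyD (polyD poly_id pp) (poly_const 2)).
have {}H : ptime (fun x => foldl (fun z y => F (tpair y z)) (tpair x (A x)) (kids (L x))).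
  by apply: H => x i; rewrite foldF sz_pair; have := bnd x i; lia.
by apply: eq_ptime (ptime_hd (ptime_tl H)) => x; rewrite foldF.
Qed.

Lemma size_encs_kids t : size (encs (kids t)) <= sz t.
Proof. by case: t => [b|l] //; rewrite szN leq_addr. Qed.

(** If the increment per turn does not depend on the accumulator, the accumulator stays polynomial,
    since the list has polynomially many items of polynomial size. *)
Lemma ptime_foldl_growth q f A L : poly q -> {homo q : m n / m <= n} ->
  (forall x y acc, sz (f x y acc) <= sz acc + q (sz x + sz y)) ->
  ptime_body f -> ptime A -> ptime L ->
  ptime (fun x => foldl (fun acc y => f x y acc) (A x) (kids (L x))).
Proof.
move=> pq mq grow pf pA pL.
have [MA [ca [sA _]]] := ptimeE pA; have [ML [cl [sL _]]] := ptimeE pL.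
pose m n := (n + 2) ^ cl.
have pp : poly (fun n => (n + 2) ^ ca + m n * q (n + m n)).
  case: pq => e He; apply: (@poly_le _ (fun n => (n + 2) ^ ca + m n * (n + m n + 2) ^ e)).
    by rewrite /m; poly_tac.
  by move=> n; rewrite leq_add2l leq_mul2l He orbT.
apply: (ptime_foldl pf pA pL pp) => x i.
have {}sA := sA x _ (leqnn _); have {}sL := sL x _ (leqnn _).
suff H l a : size (encs l) <= m (sz x) ->
    sz (foldl (fun acc y => f x y acc) a l) <= sz a + size (encs l) * q (sz x + m (sz x)).
  have le : size (encs (take i (kids (L x)))) <= m (sz x).
    apply: leq_trans sL; apply: leq_trans (size_encs_kids _).
    by rewrite -{2}(cat_take_drop i (kids (L x))) encs_cat size_cat leq_addr.
  apply: leq_trans (H _ _ le) _; apply: leq_add => //; by rewrite leq_mul2r le orbT.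
elim: l a => [|y l IH] a; first by rewrite /= addn0.
rewrite size_encs_cons => le; apply: leq_trans (IH _ _) _; first by lia.
have := grow x y a; have : q (sz x + sz y) <= q (sz x + m (sz x)) by apply: mq; lia.
by have := sz_gt0 y; move: (q _) (q _) => *; nia.
Qed.

Lemma ptime_rev L : ptime L -> ptime (fun x => Node (rev (kids (L x)))).
Proof.
move=> pL; have := @ptime_foldl_growth (fun n => n + 2) (fun _ y acc => tcons y acc)
  (fun=> Node [::]) L; case=> //; first by poly_tac.
- by move=> *; lia.
- by move=> x y acc; have := sz_cons y acc; lia.
- exact: ptime_cons (ptime_pelt ptime_id) (ptime_pacc ptime_id).
- exact: ptime_const.
have H x : foldl (fun acc y => tcons y acc) (Node [::]) (kids (L x)) = Node (rev (kids (L x))).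
  rewrite /rev; move: (kids _) [::]; elim=> //= y l IH a; exact: IH.
by move=> M [p [pp s e]]; exists M, p; split=> // [x|x m]; rewrite -H.
Qed.

Lemma ptime_foldr_growth q f A L : poly q -> {homo q : m n / m <= n} ->
  (forall x y acc, sz (f x y acc) <= sz acc + q (sz x + sz y)) ->
  ptime_body f -> ptime A -> ptime L ->
  ptime (fun x => foldr (fun y acc => f x y acc) (A x) (kids (L x))).
Proof.
move=> pq mq grow pf pA pL.
apply: eq_ptime (ptime_foldl_growth pq mq grow pf pA (ptime_rev pL)) => x.
by rewrite /= foldl_rev.
Qed.

Notation ptime_elt g := (ptime (fun t => g (penv t) (pelt t))).

Lemma ptime_elt_size g : ptime_elt g -> exists c, forall x y,
  sz (g x y) <= (sz x + sz y + 8) ^ c.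
Proof.
move=> /ptimeE [_ [c [s _]]]; exists c => x y.
(* The dummy accumulator is the empty node: together with the two pairs it adds 6 to the sizes, and
   [ptimeE] adds 2. *)
rewrite (_ : sz x + sz y + 8 = sz x + sz y + 6 + 2); last by lia.
apply: (s (tpair y (tpair x (Node [::])))).
by rewrite !sz_pair [sz (Node [::])]/=; lia.
Qed.

Lemma expD_homo k c d : {homo (fun n => (n + k) ^ c + d) : m n / m <= n}.
Proof.
move=> m n le; rewrite leq_add2r; case: c => // c.
by rewrite leq_exp2r // leq_add2r.
Qed.

Lemma ptime_map g L : ptime_elt g -> ptime L ->
  ptime (fun x => Node [seq g x y | y <- kids (L x)]).
Proof.
move=> pg pL; have [c Hc] := ptime_elt_size pg.
have := @ptime_foldr_growth (fun n => (n + 8) ^ c + 2) (fun x y acc => tcons (g x y) acc)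
  (fun=> Node [::]) L; case=> //; first by poly_tac.
- exact: expD_homo.
- by move=> x y acc; have := sz_cons (g x y) acc; have := Hc x y; lia.
- exact: ptime_cons pg (ptime_pacc ptime_id).
- exact: ptime_const.
move=> M [p [pp s e]]; apply: (@eq_ptime (fun x => foldr (fun y acc => tcons (g x y) acc)
  (Node [::]) (kids (L x)))); last by exists M, p.
by move=> x; elim: (kids _) => //= y l ->.
Qed.

Lemma ptime_filter (b : tree -> tree -> bool) L : ptime (fun t => Leaf (b (penv t) (pelt t))) ->
  ptime L -> ptime (fun x => Node [seq y <- kids (L x) | b x y]).
Proof.
move=> pb pL.
have := @ptime_foldr_growth (fun n => n + 2) (fun x y acc => if b x y then tcons y acc else acc)
  (fun=> Node [::]) L; case=> //; first by poly_tac.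
- by move=> *; lia.
- by move=> x y acc; have := sz_cons y acc; case: ifP => _; lia.
- apply: ptime_if pb _ (ptime_pacc ptime_id).
  exact: ptime_cons (ptime_pelt ptime_id) (ptime_pacc ptime_id).
- exact: ptime_const.
move=> M [p [pp s e]]; apply: (@eq_ptime (fun x => foldr
  (fun y acc => if b x y then tcons y acc else acc) (Node [::]) (kids (L x)))); last by exists M, p.
by move=> x; elim: (kids _) => //= y l ->; case: ifP.
Qed.

Lemma ptime_has (b : tree -> tree -> bool) L : ptime (fun t => Leaf (b (penv t) (pelt t))) ->
  ptime L -> ptime (fun x => Leaf (has (b x) (kids (L x)))).
Proof.
move=> pb pL.
have := @ptime_foldr_growth (fun n => n + 2) (fun x y acc => if b x y then Leaf true else acc)
  (fun=> Leaf false) L; case=> //; first by poly_tac.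
- by move=> *; lia.
- by move=> x y acc; case: ifP => _; rewrite ?[sz (Leaf _)]/=; lia.
- by apply: ptime_if pb (ptime_const _) (ptime_pacc ptime_id).
- exact: ptime_const.
move=> M [p [pp s e]]; apply: (@eq_ptime (fun x => foldr
  (fun y acc => if b x y then Leaf true else acc) (Leaf false) (kids (L x)))); last by exists M, p.
by move=> x; elim: (kids _) => //= y l ->; case: ifP.
Qed.

Lemma ptime_all (b : tree -> tree -> bool) L : ptime (fun t => Leaf (b (penv t) (pelt t))) ->
  ptime L -> ptime (fun x => Leaf (all (b x) (kids (L x)))).
Proof.
move=> /ptime_negb pb pL.
apply: eq_ptime (ptime_negb (@ptime_has (fun x y => ~~ b x y) L pb pL)) => x.
by rewrite -all_predC; congr Leaf; apply: eq_all => y /=; rewrite negbK.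
Qed.

Definition tcat a b := foldr tcons b (kids a).

Lemma tcatE a b : tcat (Node a) (Node b) = Node (a ++ b).
Proof. by rewrite /tcat; elim: a => //= x a ->. Qed.

Lemma ptime_cat A B : ptime A -> ptime B -> ptime (fun x => tcat (A x) (B x)).
Proof.
move=> pA pB; have := @ptime_foldr_growth (fun n => n + 2) (fun _ y acc => tcons y acc) B A.
case=> //; first by poly_tac.
- by move=> *; lia.
- by move=> x y acc; have := sz_cons y acc; lia.
- exact: ptime_cons (ptime_pelt ptime_id) (ptime_pacc ptime_id).
by move=> M [p [pp s e]]; exists M, p.
Qed.

(** The state consists of the unread part of the second list and the reversed result. *)
Definition zip_step y s :=
  tpair (ttl (thd s)) (tcons (tpair y (thd (thd s))) (thd (ttl s))).

Definition tzip a b :=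
  Node (rev (kids (thd (ttl (foldl (fun s y => zip_step y s) (tpair b (Node [::])) (kids a)))))).

Lemma tzipE (T : Type) (F G : T -> tree) s :
  tzip (Node (map F s)) (Node (map G s)) = Node [seq tpair (F i) (G i) | i <- s].
Proof.
rewrite /tzip [kids (Node (map F s))]/=; congr Node.
suff H a : kids (thd (ttl (foldl (fun s y => zip_step y s) (tpair (Node (map G s)) (Node a))
    (map F s)))) = catrev [seq tpair (F i) (G i) | i <- s] a by rewrite H -/(rev _) revK.
by elim: s a => //= i s IH a; rewrite -IH.
Qed.

(** The slack covers leaves and the empty node, whose head and tail are both the empty node. *)
Lemma sz_hd_tl t : sz (thd t) + sz (ttl t) <= sz t + 4.
Proof.
case: t => [b|[|x l]]; rewrite /thd /ttl /kids //=.
by rewrite !size_cat /= ?size_cat; lia.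
Qed.

Lemma ptime_zip A B : ptime A -> ptime B -> ptime (fun x => tzip (A x) (B x)).
Proof.
move=> pA pB; apply: ptime_rev; apply: ptime_hd; apply: ptime_tl.
have := @ptime_foldl_growth (fun n => n + 20) (fun _ y s => zip_step y s)
  (fun x => tpair (B x) (Node [::])) A; case=> //; first by poly_tac.
- by move=> *; lia.
- move=> x y s; rewrite /zip_step sz_pair.
  have := sz_cons (tpair y (thd (thd s))) (thd (ttl s)); rewrite sz_pair.
  have := sz_hd_tl s; have := sz_hd_tl (thd s); have := sz_hd_tl (ttl s).
  have := sz_gt0 (ttl (ttl s)); lia.
- apply: ptime_pair; first exact: ptime_tl (ptime_hd (ptime_pacc ptime_id)).
  apply: ptime_cons; last exact: ptime_hd (ptime_tl (ptime_pacc ptime_id)).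
  exact: ptime_pair (ptime_pelt ptime_id) (ptime_hd (ptime_hd (ptime_pacc ptime_id))).
- exact: ptime_pair pB (ptime_const _).
by move=> M [p [pp s e]]; exists M, p.
Qed.

(** The state consists of the unread part of the second list and the verdict so far. Items are
    compared as leaves, which suffices because only numerals are ever compared. *)
Definition eq_step y s := tpair (ttl (thd s)) (Leaf
  (truth (thd (ttl s)) && ~~ isnil (thd s) && ~~ (truth y (+) truth (thd (thd s))))).

Definition eq_state a b := foldl (fun s y => eq_step y s) (tpair b (Leaf true)) (kids a).

Definition teq a b :=
  truth (thd (ttl (eq_state a b))) && isnil (thd (eq_state a b)).

Lemma teqE u v : teq (Node (map Leaf u)) (Node (map Leaf v)) = (u == v).
Proof.
suff H c : let s := foldl (fun s y => eq_step y s)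
      (tpair (Node (map Leaf v)) (Leaf c)) (map Leaf u) in
    truth (thd (ttl s)) && isnil (thd s) = c && (u == v).
  by rewrite /teq /eq_state H.
elim: u v c => [|x u IH] [|y v] c /=; rewrite ?andbT ?andbF //.
  (* The second numeral is exhausted first, and from then on the verdict remains false. *)
  set s := foldl _ _ _; suff : truth (thd (ttl s)) = false by move->.
  rewrite {}/s [eq_step _ _](_ : _ = tpair (Node [::]) (Leaf false)); last first.
    by rewrite /eq_step /= andbF.
  by elim: u {IH} => //= z u.
rewrite [eq_step _ _](_ : _ = tpair (Node (map Leaf v)) (Leaf (c && (x == y)))); last first.
  by rewrite /eq_step /= andbT; case: x; case: y.
by rewrite IH eqseq_cons andbA.
Qed.

Lemma ptime_eq A B : ptime A -> ptime B -> ptime (fun x => Leaf (teq (A x) (B x))).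
Proof.
move=> pA pB; suff pS : ptime (fun x => eq_state (A x) (B x)).
  by apply: ptime_andb; [exact: ptime_truth (ptime_hd (ptime_tl pS))
                        | exact: ptime_nilb (ptime_hd pS)].
have := @ptime_foldl_growth (fun n => n + 20) (fun _ y s => eq_step y s)
  (fun x => tpair (B x) (Leaf true)) A; case=> //; first by poly_tac.
- by move=> *; lia.
- move=> x y s; rewrite /eq_step sz_pair [sz (Leaf _)]/=.
  have := sz_hd_tl s; have := sz_hd_tl (thd s); have := sz_gt0 (ttl s).
  by have := sz_gt0 (thd (thd s)); lia.
- have pa := ptime_pacc ptime_id; have pe := ptime_pelt ptime_id.
  apply: ptime_pair; first exact: ptime_tl (ptime_hd pa).
  apply: ptime_andb; first apply: ptime_andb.
  + exact: ptime_truth (ptime_hd (ptime_tl pa)).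
  + exact: ptime_negb (ptime_nilb (ptime_hd pa)).
  exact: ptime_negb (ptime_addb (ptime_truth pe) (ptime_truth (ptime_hd (ptime_hd pa)))).
- exact: ptime_pair pB (ptime_const _).
by move=> M [p [pp s e]]; exists M, p.
Qed.

(** * Arithmetic on binary numerals, least significant digit first *)

Fixpoint addc (c : bool) (u : seq bool) : seq bool :=
  if u is b :: u' then (c (+) b) :: addc (c && b) u' else nseq c true.

Lemma addc0 u : addc false u = u. Proof. by elim: u => //= b u ->. Qed.

Lemma size_addc c u : size (addc c u) <= size u + 1.
Proof. by elim: u c => [[]|b u IH] //= c; rewrite addSn ltnS. Qed.

Definition succ_step y s := tpair (Leaf (truth (thd s) && truth y))
  (tcons (Leaf (truth (thd s) (+) truth y)) (thd (ttl s))).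

Definition succ_state t :=
  foldl (fun s y => succ_step y s) (tpair (Leaf true) (Node [::])) (kids t).

(** The state holds the carry and the reversed digits; a final carry becomes a new most significant
    digit. *)
Definition tsucc t :=
  Node (rev (kids (if truth (thd (succ_state t)) then tcons (Leaf true) (thd (ttl (succ_state t)))
                   else thd (ttl (succ_state t))))).

Lemma tsuccE t : tsucc t = Node (map Leaf (addc true (map truth (kids t)))).
Proof.
rewrite /tsucc; congr Node; rewrite /succ_state; move: (kids t) => l.
suff H c a : let s := foldl (fun s y => succ_step y s) (tpair (Leaf c) (Node a)) l in
    kids (if truth (thd s) then tcons (Leaf true) (thd (ttl s)) else thd (ttl s)) =
    catrev (map Leaf (addc c (map truth l))) a by rewrite H -/(rev _) revK.
by elim: l c a => [|y l IH] [] a //=; rewrite -IH.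
Qed.

Lemma sz_bits u : sz (Node (map Leaf u)) = size u + 2.
Proof.
rewrite szN; congr addn; elim: u => // b u IH.
by rewrite [map Leaf _]/= size_encs_cons IH.
Qed.

Lemma size_kids t : size (kids t) <= sz t.
Proof. exact: leq_trans (leq_size_encs _) (size_encs_kids t). Qed.

Lemma sz_succ t : sz (tsucc t) <= sz t + 3.
Proof.
rewrite tsuccE sz_bits; have := size_addc true (map truth (kids t)).
by rewrite size_map; have := size_kids t; lia.
Qed.

Lemma ptime_succ A : ptime A -> ptime (fun x => tsucc (A x)).
Proof.
move=> pA; suff pS : ptime (fun x => succ_state (A x)).
  apply: ptime_rev; apply: ptime_if.
  - exact: ptime_truth (ptime_hd pS).
  - exact: ptime_cons (ptime_const _) (ptime_hd (ptime_tl pS)).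
  - exact: ptime_hd (ptime_tl pS).
have := @ptime_foldl_growth (fun n => n + 20) (fun _ y s => succ_step y s)
  (fun x => tpair (Leaf true) (Node [::])) A; case=> //; first by poly_tac.
- by move=> *; lia.
- move=> x y s; rewrite /succ_step sz_pair [sz (Leaf _)]/=.
  have := sz_hd_tl s; have := sz_hd_tl (ttl s); have := sz_gt0 (ttl (ttl s)).
  have := sz_cons (Leaf (truth (thd s) (+) truth y)) (thd (ttl s)).
  by rewrite [sz (Leaf _)]/=; lia.
- have pa := ptime_pacc ptime_id; have pe := ptime_pelt ptime_id.
  apply: ptime_pair; first exact: ptime_andb (ptime_truth (ptime_hd pa)) (ptime_truth pe).
  apply: ptime_cons; first exact: ptime_addb (ptime_truth (ptime_hd pa)) (ptime_truth pe).
  exact: ptime_hd (ptime_tl pa).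
- exact: ptime_const.
by move=> M [p [pp s e]]; exists M, p.
Qed.

Definition tlen t := foldl (fun acc _ => tsucc acc) (Node [::]) (kids t).

Lemma ptime_len A : ptime A -> ptime (fun x => tlen (A x)).
Proof.
move=> pA; have := @ptime_foldl_growth (fun n => n + 3) (fun _ _ s => tsucc s)
  (fun x => Node [::]) A; case=> //; first by poly_tac.
- by move=> *; lia.
- by move=> x y s; have := sz_succ s; lia.
- exact: ptime_succ (ptime_pacc ptime_id).
- exact: ptime_const.
by move=> M [p [pp s e]]; exists M, p.
Qed.

(** Only the length of [t] matters. The head of the accumulator is always the next number, so the
    last one computed is surplus and removed by [ttl]. *)
Definition tiota c t := Node (rev (kids (ttl
  (foldl (fun acc _ => tcons (tsucc (thd acc)) acc) (Node [:: c]) (kids t))))).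

(** The item added in a turn is computed from the accumulator, so its size is not bounded by
    environment and list element alone. The bound is derived directly: a numeral grows by at most 3
    per turn. *)
Lemma ptime_iota C A : ptime C -> ptime A -> ptime (fun x => tiota (C x) (A x)).
Proof.
move=> pC pA; apply: ptime_rev; apply: ptime_tl.
have [_ [c [sC _]]] := ptimeE pC; have [_ [d [sA _]]] := ptimeE pA.
pose p n := (n + 2) ^ c + 2 + (n + 2) ^ d * ((n + 2) ^ c + 3 * (n + 2) ^ d).
apply: (@ptime_foldl (fun _ _ acc => tcons (tsucc (thd acc)) acc)
  (fun x => Node [:: C x]) A p) => //.
- have pa := ptime_pacc ptime_id; exact: ptime_cons (ptime_succ (ptime_hd pa)) pa.
- exact: ptime_cons pC (ptime_const (Node [::])).
- by rewrite /p; poly_tac.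
move=> x i; set l := take i _.
suff H a r : sz (foldl (fun acc _ => tcons (tsucc (thd acc)) acc) (Node (a :: r)) l) <=
    sz (Node (a :: r)) + size l * (sz a + 3 * size l).
  apply: leq_trans (H _ _) _.
  have l_le : size l <= (sz x + 2) ^ d.
    apply: leq_trans (sA x _ (leqnn _)); apply: leq_trans (size_kids _).
    by rewrite size_take; case: ltnP => // /ltnW.
  have := sC x _ (leqnn _); rewrite /p szN size_encs_cons [size (encs [::])]/= addn0.
  move=> C_le; apply: leq_add; first by rewrite leq_add2r.
  by apply: leq_mul => //; apply: leq_add => //; rewrite leq_mul2l.
elim: l a r => [|y l IH] a r; first by rewrite addn0.
apply: leq_trans (IH (tsucc a) (a :: r)) _; move: (tsucc a) (sz_succ a) => a'.
rewrite !szN !size_encs_cons [size (y :: l)]/=.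
move: (sz a') (sz a) (size l) (size (encs r)) => b n k e le.
have : k * (b + 3 * k) <= k * (n + 3 + 3 * k) by rewrite leq_mul2l leq_add2r le orbT.
by move: (k * (b + 3 * k)) => z; nia.
Qed.

Definition bits n : seq bool := if bin_of_nat n is Npos p then pos_bits p else [::].

Definition tnat n := Node (map Leaf (bits n)).

Lemma bits_inj : injective bits.
Proof.
move=> m n; rewrite /bits -{2}(bin_of_natK m) -{2}(bin_of_natK n).
have pbn p : pos_bits p <> [::] by case: p.
case: (bin_of_nat m) (bin_of_nat n) => [|p] [|q] //.
- by move=> /esym /pbn.
- by move=> /pbn.
move=> e; suff -> : p = q by [].
elim: p q e => [p IH|p IH|] [q|q|] //= [].
- by move=> /IH ->.
- by move=> /pbn.
- by move=> /IH ->.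
- by move=> /esym /pbn.
Qed.

Lemma bitsS n : bits n.+1 = addc true (bits n).
Proof.
have Spos p : nat_of_pos (Pos.succ p) = (nat_of_pos p).+1.
  by elim: p => //= p ->; rewrite !natTrecE.
have e : n.+1 = nat_of_bin (N.succ (bin_of_nat n)).
  by rewrite -{1}(bin_of_natK n); case: (bin_of_nat n) => //= p; rewrite Spos.
rewrite {1}/bits e nat_of_binK /bits; case: (bin_of_nat n) => //= p.
by elim: p => [p IH|p IH|] //=; rewrite ?IH ?addc0.
Qed.

Lemma tsucc_nat n : tsucc (tnat n) = tnat n.+1.
Proof. by rewrite tsuccE /tnat bitsS /= -map_comp map_id. Qed.

Lemma teq_nat m n : teq (tnat m) (tnat n) = (m == n).
Proof. by rewrite teqE (inj_eq bits_inj). Qed.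

Lemma isnil_nat n : isnil (tnat n) = (n == 0).
Proof.
rewrite -(inj_eq bits_inj) /isnil /tnat /=; by case: (bits n).
Qed.

Lemma tlenE l : tlen (Node l) = tnat (size l).
Proof.
rewrite /tlen /= -[Node [::]]/(tnat 0) -[size l]add0n.
by elim: l 0 => [|y l IH] n; rewrite ?addn0 //= tsucc_nat IH addnS addSn.
Qed.

Lemma tiotaE m l : tiota (tnat m) (Node l) = Node (map tnat (iota m (size l))).
Proof.
rewrite /tiota /=; congr Node.
suff H n a : foldl (fun acc _ => tcons (tsucc (thd acc)) acc) (Node (tnat n :: a)) l =
    Node (catrev (map tnat (iota n (size l).+1)) a).
  by rewrite H -/(rev _) -addn1 iotaD map_cat rev_cat /= revK.
elim: l n a => [|y l IH] n a //=.
by rewrite /tcons /= tsucc_nat IH.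
Qed.

(** * The conservative system *)

Section Conservative.
Variable E : eos.

(* [inr n] is a trash place of type [n]. *)
Definition rplace : finType := (place (sys E) + obj E)%type.
(* [inr p] is the idle transition of [p]; the former idle transitions are
   ordinary transitions [inl _], hence the idling condition on events is void. *)
Definition rtrans : finType := (trans (sys E) + rplace)%type.

Definition rpre (p : rplace) (t : rtrans) : nat :=
  match t with
  | inl t' => if p is inl p' then flow_pt p' t' else 0
  | inr p' => p == p'
  end.

Definition rpost (t : rtrans) (p : rplace) : nat :=
  match t with
  | inl t' => if p is inl p' then flow_tp t' p' else 1
  | inr p' => p == p'
  end.

Definition rsys : pn := PN rpre rpost.

Definition rtyp (p : rplace) : obj E := match p with inl p' => typ p' | inr n => n end.

(* An event that produces tokens of the net [n] without outputting a nested
   token of type [n] can never fire in [E], but could fire into the trash. *)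
Definition live (e : event E) : bool :=
  [forall n, ~~ [exists u : trans (net n), (e.2 n u != 0) && [exists q, post u q != 0]]
          || [exists p, (post e.1 p != 0) && (typ p == n)]].

Definition revents : seq (rtrans * {dffun forall n : obj E, tmultiset (net n)}) :=
  [seq (inl e.1, e.2) | e <- events E & live e].

Lemma ridle_pre p q : @pre rsys (inr p) q = (q == p).
Proof. by []. Qed.

Lemma ridle_post p q : @post rsys (inr p) q = (q == p).
Proof. by []. Qed.

Lemma revents_uniq : uniq revents.
Proof.
rewrite map_inj_uniq ?filter_uniq ?events_uniq //.
by move=> [t1 th1] [t2 th2] [-> ->].
Qed.

Lemma revents_idle e : e \in revents -> forall p, e.1 = inr p ->
  exists t, e.2 (rtyp p) t != 0.
Proof. by case/mapP=> e' _ -> p. Qed.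

Definition reos : eos :=
  @EOS rsys inr (obj E) (@net E) (black E) rtyp revents
    ridle_pre ridle_post (@blackP E) revents_uniq revents_idle.

(** An ordinary transition outputs to the trash places of all types, and an idle transition has
    equal inputs and outputs. *)
Lemma reos_conservative : conservative reos.
Proof.
case=> [t|p]; last by [].
apply/subsetP => n _; apply/imsetP; exists (inr n : place (sys reos)) => //.
by rewrite inE.
Qed.

Definition emb (x : ntoken E) : ntoken reos := @NTok reos (inl (nplace x)) (nmarking x).

End Conservative.

Definition reduce (x : cov_instance) : pb_instance cEOS_coverability :=
  exist (fun y : cov_instance => conservative (ci_eos y))
    (@CovInstance (reos (ci_eos x))
       [seq (emb y.1, y.2) | y <- ci_init x] [seq (emb y.1, y.2) | y <- ci_target x])
    (@reos_conservative (ci_eos x)).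

(** * The reduction on encodings *)

Definition tfun (T : finType) (f : T -> nat) := Node [seq tnat (f x) | x <- enum T].
Definition telt (T : finType) (x : T) := tnat (index x (enum T)).
Definition tpn (N : pn) :=
  Node [:: Node [seq tfun (@flow_pt N p) | p <- enum (place N)];
           Node [seq tfun (@flow_tp N t) | t <- enum (trans N)]].
Definition tevent (E : eos) (e : event E) :=
  Node [:: telt e.1; Node [seq tfun (e.2 n) | n <- enum (obj E)]].
Definition teos (E : eos) :=
  Node [:: tpn (sys E);
           Node [seq telt (idle p) | p <- enum (place (sys E))];
           Node [seq tpn (net n) | n <- enum (obj E)];
           telt (black E);
           Node [seq telt (typ p) | p <- enum (place (sys E))];
           Node [seq tevent e | e <- events E]].
Definition tconfig (E : eos) (s : presentation E) :=
  Node [seq Node [:: telt (nplace x.1); tfun (nmarking x.1); tnat x.2] | x <- s].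
Definition tcov (x : cov_instance) :=
  Node [:: teos (ci_eos x); tconfig (ci_init x); tconfig (ci_target x)].

Lemma enc_Node ts : enc (Node ts) = enc_list (map enc ts). Proof. by []. Qed.

Lemma enc_Node_map (T : Type) (F : T -> tree) (H : T -> seq symbol) s :
  (forall x, enc (F x) = H x) -> enc (Node (map F s)) = enc_list (map H s).
Proof. by move=> e; rewrite enc_Node -map_comp (eq_map e). Qed.

Lemma enc_tnat n : enc (tnat n) = enc_nat n.
Proof.
rewrite enc_Node -map_comp /enc_nat -/(bits n) /enc_list; congr bracket.
by elim: (bits n) => //= b u ->.
Qed.

Lemma enc_tfun (T : finType) (f : T -> nat) : enc (tfun f) = enc_fun f.
Proof. by apply: enc_Node_map => x; apply: enc_tnat. Qed.

Lemma enc_Node2 a b : enc (Node [:: a; b]) = enc_list [:: enc a; enc b].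
Proof. by []. Qed.

Lemma enc_Node3 a b c : enc (Node [:: a; b; c]) = enc_list [:: enc a; enc b; enc c].
Proof. by []. Qed.

Lemma enc_tpn N : enc (tpn N) = enc_pn N.
Proof.
rewrite enc_Node2; congr (enc_list [:: _; _]);
  by apply: enc_Node_map => x; apply: enc_tfun.
Qed.

Lemma enc_tevent E (e : event E) : enc (tevent e) = enc_event e.
Proof.
rewrite enc_Node2 enc_tnat; congr (enc_list [:: _; _]).
by apply: enc_Node_map => n; apply: enc_tfun.
Qed.

Lemma enc_teos E : enc (teos E) = enc_eos E.
Proof.
transitivity (enc_list [:: enc (tpn (sys E));
  enc (Node [seq telt (idle p) | p <- enum (place (sys E))]);
  enc (Node [seq tpn (net n) | n <- enum (obj E)]); enc (telt (black E));
  enc (Node [seq telt (typ p) | p <- enum (place (sys E))]);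
  enc (Node [seq tevent e | e <- events E])]); first by [].
rewrite enc_tpn enc_tnat; congr (enc_list [:: _; _; _; _; _; _]);
  apply: enc_Node_map => x; by [apply: enc_tnat | apply: enc_tpn | apply: enc_tevent].
Qed.

Lemma enc_tconfig E (s : presentation E) : enc (tconfig s) = enc_config s.
Proof. by apply: enc_Node_map => y; rewrite enc_Node3 !enc_tnat enc_tfun. Qed.

Lemma enc_tcov x : enc (tcov x) = enc_cov x.
Proof. by rewrite enc_Node3 enc_teos !enc_tconfig. Qed.

Definition sub k t := thd (iter k ttl t).

Definition g_fpt x := sub 0 (sub 0 (sub 0 x)).
Definition g_ftp x := sub 1 (sub 0 (sub 0 x)).
Definition g_nets x := sub 2 (sub 0 x).
Definition g_typ x := sub 4 (sub 0 x).
Definition g_events x := sub 5 (sub 0 x).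
(** The two lists are only measured: numbers are assigned first to the given places and then to the
    trash places, one for each object net. *)
Definition g_places x := tiota (tnat 0) (tcat (g_fpt x) (g_nets x)).
(** The identity matrix is the flow between the places and their idle transitions, in either
    direction. *)
Definition g_unit x :=
  Node [seq Node [seq (if teq i j then tnat 1 else tnat 0) | j <- kids (g_places x)]
       | i <- kids (g_places x)].
(** Trash places get zero rows for the ordinary transitions; the identity matrix then adds one
    column per idle transition. *)
Definition g_pre x :=
  Node [seq tcat (sub 0 ab) (sub 1 ab) | ab <- kids (tzip
    (tcat (g_fpt x)
       (Node [seq Node [seq tnat 0 | _ <- kids (g_ftp x)] | _ <- kids (g_nets x)]))
    (g_unit x))].
Definition g_post x :=
  tcat (Node [seq tcat r (Node [seq tnat 1 | _ <- kids (g_nets x)]) | r <- kids (g_ftp x)])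
       (g_unit x).
Definition g_idle x := tiota (tlen (g_ftp x)) (g_places x).
Definition g_rtyp x := tcat (g_typ x) (tiota (tnat 0) (g_nets x)).
(** [isnil] serves as the zero test, since the numeral of 0 has no digits. *)
Definition g_produces th net :=
  has (fun ur => ~~ isnil (sub 0 ur) && has (fun w => ~~ isnil w) (kids (sub 1 ur)))
      (kids (tzip th (sub 1 net))).
(** Lists have no random access: the row of the transition [t] is found by comparing [t] with the
    number of every row. *)
Definition g_outputs x t i :=
  has (fun jr => teq (sub 0 jr) t &&
         has (fun wt => ~~ isnil (sub 0 wt) && teq (sub 1 wt) i)
             (kids (tzip (sub 1 jr) (g_typ x))))
      (kids (tzip (tiota (tnat 0) (g_ftp x)) (g_ftp x))).
Definition g_live x e :=
  all (fun k => ~~ g_produces (sub 0 (sub 1 k)) (sub 1 (sub 1 k))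
                || g_outputs x (sub 0 e) (sub 0 k))
      (kids (tzip (tiota (tnat 0) (g_nets x)) (tzip (sub 1 e) (g_nets x)))).
Definition g_revents x := Node [seq e <- kids (g_events x) | g_live x e].
Definition g_reduce x :=
  Node [:: Node [:: Node [:: g_pre x; g_post x]; g_idle x; g_nets x; sub 3 (sub 0 x);
                    g_rtyp x; g_revents x];
           sub 1 x; sub 2 x].

Lemma ptime_node_cons f l : ptime f -> ptime (fun x => Node (l x)) ->
  ptime (fun x => Node (f x :: l x)).
Proof. exact: ptime_cons. Qed.

Ltac ptime_tac := repeat (cbv beta; lazymatch goal with
  | |- ptime (fun _ => ?c) => exact: ptime_const
  | |- ptime (fun x => x) => exact: ptime_id
  | |- ptime pelt => exact: (ptime_pelt ptime_id)
  | |- ptime penv => exact: (ptime_penv ptime_id)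
  | |- ptime thd => exact: ptime_thd
  | |- ptime ttl => exact: ptime_ttl
  | |- ptime (fun x => thd _) => apply: ptime_hd
  | |- ptime (fun x => ttl _) => apply: ptime_tl
  | |- ptime (fun x => penv _) => apply: ptime_penv
  | |- ptime (fun x => pelt _) => apply: ptime_pelt
  | |- ptime (fun x => pacc _) => apply: ptime_pacc
  | |- ptime (fun x => tcat _ _) => apply: ptime_cat
  | |- ptime (fun x => tzip _ _) => apply: ptime_zip
  | |- ptime (fun x => tiota _ _) => apply: ptime_iota
  | |- ptime (fun x => tlen _) => apply: ptime_len
  | |- ptime (fun x => if _ then _ else _) => apply: ptime_if
  | |- ptime (fun x => Leaf (teq _ _)) => apply: ptime_eq
  | |- ptime (fun x => Leaf (isnil _)) => apply: ptime_nilb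
  | |- ptime (fun x => Leaf (~~ _)) => apply: ptime_negb
  | |- ptime (fun x => Leaf (_ && _)) => apply: ptime_andb
  | |- ptime (fun x => Leaf (_ || _)) => apply: ptime_orb
  | |- ptime (fun x => Leaf (has _ (kids _))) => apply: ptime_has
  | |- ptime (fun x => Leaf (all _ (kids _))) => apply: ptime_all
  | |- ptime (fun x => Node (_ :: _)) => apply: ptime_node_cons
  | |- ptime (fun x => Node (map _ (kids _))) => apply: ptime_map
  | |- ptime (fun x => Node (filter _ (kids _))) => apply: ptime_filter
  end).

Lemma ptime_reduce : ptime g_reduce.
Proof.
cbv [g_reduce g_revents g_live g_outputs g_produces g_rtyp g_idle g_post g_pre
     g_unit g_places g_events g_typ g_nets g_ftp g_fpt sub iter].
ptime_tac.
Qed.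

(** * The tree program computes the encoding of the new instance *)

Lemma enum_sum (A B : finType) :
  enum ((A + B)%type : finType) = [seq inl a | a <- enum A] ++ [seq inr b | b <- enum B].
Proof. by rewrite !enumT [in LHS]unlock. Qed.

Lemma telt_inl (A B : finType) (a : A) : telt (inl a : (A + B)%type) = telt a.
Proof.
rewrite /telt enum_sum index_cat mem_map ?mem_enum //; last by move=> ? ? [].
by rewrite index_map // => ? ? [].
Qed.

Lemma index_inr (A B : finType) (b : B) :
  index (inr b : (A + B)%type) (enum ((A + B)%type : finType)) = #|A| + index b (enum B).
Proof.
rewrite enum_sum index_cat size_map -cardE ifF; last by apply/mapP => -[].
by rewrite index_map // => ? ? [].
Qed.

Lemma map_index (T : eqType) (s : seq T) : uniq s -> [seq index x s | x <- s] = iota 0 (size s).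
Proof.
case: s => // x0 s us; set r := x0 :: s in us *.
apply: (@eq_from_nth _ 0); rewrite size_map ?size_iota // => i ir.
by rewrite (nth_map x0) // index_uniq // nth_iota.
Qed.

(** An element is encoded by its position, so listing a type amounts to counting from 0. *)
Lemma tiota_enum (T : finType) l : size l = #|T| ->
  tiota (tnat 0) (Node l) = Node (map (@telt T) (enum T)).
Proof.
by move=> e; rewrite tiotaE e cardE -map_index ?enum_uniq // -map_comp.
Qed.

Lemma teq_elt (T : finType) (x y : T) : teq (telt x) (telt y) = (x == y).
Proof.
rewrite teq_nat; apply/eqP/eqP => [e|-> //].
by rewrite -(nth_index x (mem_enum T x)) e nth_index // mem_enum.
Qed.

Lemma has_enum (T : finType) (a : pred T) : has a (enum T) = [exists x, a x].
Proof.
apply/hasP/existsP => [[x _ ax]|[x ax]]; exists x => //; exact: mem_enum.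
Qed.

Lemma all_enum (T : finType) (a : pred T) : all a (enum T) = [forall x, a x].
Proof.
apply/allP/forallP => H x //; apply: H; exact: mem_enum.
Qed.

Lemma tfun_sum (A B : finType) (f : (A + B)%type -> nat) :
  tfun f = Node ([seq tnat (f (inl a)) | a <- enum A] ++ [seq tnat (f (inr b)) | b <- enum B]).
Proof. by rewrite /tfun enum_sum map_cat -!map_comp. Qed.

Lemma kidsN l : kids (Node l) = l. Proof. by []. Qed.

Section GReduce.
Variable x : cov_instance.
Let E := ci_eos x.
Let X := tcov x.

Lemma g_fptE : g_fpt X = Node [seq tfun (@flow_pt (sys E) p) | p <- enum (place (sys E))].
Proof. by []. Qed.

Lemma g_ftpE : g_ftp X = Node [seq tfun (@flow_tp (sys E) t) | t <- enum (trans (sys E))].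
Proof. by []. Qed.

Lemma g_netsE : g_nets X = Node [seq tpn (net n) | n <- enum (obj E)].
Proof. by []. Qed.

Lemma g_typE : g_typ X = Node [seq telt (typ p) | p <- enum (place (sys E))].
Proof. by []. Qed.

Lemma g_eventsE : g_events X = Node [seq tevent e | e <- events E].
Proof. by []. Qed.

Lemma g_placesE : g_places X = Node (map (@telt (rplace E)) (enum (rplace E))).
Proof.
rewrite /g_places g_fptE g_netsE tcatE; apply: tiota_enum.
by rewrite size_cat 2!size_map card_sum !cardE.
Qed.

Lemma g_unitE : g_unit X = Node [seq tfun (fun j => (i == j) : nat) | i <- enum (rplace E)].
Proof.
rewrite /g_unit g_placesE /= -map_comp; congr Node; apply: eq_map => i /=.
rewrite -map_comp; congr Node; apply: eq_map => j /=.
by rewrite teq_elt; case: eqP.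
Qed.

Lemma g_preE : g_pre X = Node [seq tfun (@rpre E p) | p <- enum (rplace E)].
Proof.
rewrite /g_pre g_fptE g_netsE g_ftpE g_unitE tcatE.
pose H (p : rplace E) := if p is inl p' then tfun (@flow_pt (sys E) p')
  else Node [seq tnat 0 | _ <- enum (trans (sys E))].
rewrite (_ : _ ++ _ = map H (enum (rplace E))); last first.
  rewrite enum_sum map_cat -!map_comp; congr cat; apply: eq_map => n /=.
  by rewrite -map_comp.
rewrite tzipE kidsN -map_comp; congr Node; apply: eq_map => p /=.
by rewrite [RHS]tfun_sum /sub /tfun; case: p => p; rewrite /thd /= tcatE.
Qed.

Lemma g_postE : g_post X = Node [seq tfun (@rpost E t) | t <- enum (rtrans E)].
Proof.
rewrite /g_post g_netsE g_ftpE g_unitE tcatE.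
rewrite [enum (rtrans E)]enum_sum map_cat -!map_comp; congr (Node (_ ++ _));
  apply: eq_map => t /=.
  by rewrite -enumT [RHS]tfun_sum /tfun tcatE.
by congr Node; apply: eq_map => p; rewrite eq_sym.
Qed.

Lemma g_idleE : g_idle X = Node [seq telt (inr p : rtrans E) | p <- enum (rplace E)].
Proof.
rewrite /g_idle g_ftpE g_placesE tlenE tiotaE 2!size_map -2!cardE; congr Node.
have -> : iota #|trans (sys E)| #|rplace E| =
    [seq #|trans (sys E)| + index p (enum (rplace E)) | p <- enum (rplace E)].
  by rewrite (map_comp (addn _)) map_index ?enum_uniq // -iotaDl addn0 !cardE.
by rewrite -map_comp; apply: eq_map => p; rewrite /telt index_inr.
Qed.

Lemma g_rtypE : g_rtyp X = Node [seq telt (rtyp p) | p <- enum (rplace E)].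
Proof.
rewrite /g_rtyp g_netsE g_typE (@tiota_enum (obj E)); last first.
  by rewrite size_map -cardE.
by rewrite tcatE enum_sum map_cat -!map_comp.
Qed.

Lemma g_liveE (e : event E) : g_live X (tevent e) = live e.
Proof.
rewrite /g_live g_netsE (@tiota_enum (obj E)); last by rewrite size_map -cardE.
rewrite (_ : sub 1 (tevent e) = Node [seq tfun (e.2 n) | n <- enum (obj E)]) //.
rewrite !tzipE kidsN all_map all_enum; apply: eq_forallb => n.
transitivity (~~ g_produces (tfun (e.2 n)) (tpn (net n)) || g_outputs X (telt e.1) (telt n)).
  by [].
congr (~~ _ || _).
  rewrite /g_produces (_ : sub 1 (tpn (net n)) =
    Node [seq tfun (@flow_tp (net n) u) | u <- enum (trans (net n))]) // {1}/tfun tzipE.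
  rewrite kidsN has_map has_enum; apply: eq_existsb => u.
  transitivity (~~ isnil (tnat (e.2 n u)) &&
    has (fun w => ~~ isnil w) (kids (tfun (@flow_tp (net n) u)))); first by [].
  rewrite isnil_nat /tfun kidsN has_map has_enum; congr andb.
  by apply: eq_existsb => q; rewrite /= isnil_nat.
have tS t : has (fun wt => ~~ isnil (sub 0 wt) && teq (sub 1 wt) (telt n))
    (kids (tzip (tfun (@flow_tp (sys E) t)) (g_typ X))) =
    [exists p, (post t p != 0) && (typ p == n)].
  rewrite g_typE /tfun tzipE kidsN has_map has_enum; apply: eq_existsb => p.
  transitivity (~~ isnil (tnat (flow_tp t p)) && teq (telt (typ p)) (telt n)); first by [].
  by rewrite isnil_nat teq_elt.
rewrite /g_outputs g_ftpE (@tiota_enum (trans (sys E))); last by rewrite size_map -cardE.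
rewrite tzipE kidsN has_map has_enum -tS.
transitivity [exists t, teq (telt t) (telt e.1) &&
  has (fun wt => ~~ isnil (sub 0 wt) && teq (sub 1 wt) (telt n))
    (kids (tzip (tfun (@flow_tp (sys E) t)) (g_typ X)))]; first by [].
(* Distinct transitions have distinct numbers, so the search through all rows succeeds exactly at
   the row of [e.1]. *)
apply/existsP/idP => [[t]|H]; first by rewrite teq_elt => /andP [/eqP ->].
by exists e.1; rewrite teq_elt eqxx.
Qed.

(** [inl] preserves the number of a transition and the object nets are unchanged, so the surviving
    events are copied verbatim. *)
Lemma g_reventsE : g_revents X = Node [seq @tevent (reos E) e | e <- revents E].
Proof.
rewrite /g_revents g_eventsE kidsN filter_map /revents -map_comp; congr Node.
rewrite (eq_filter (a2 := @live E)); last by move=> e /=; apply: g_liveE.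
by apply: eq_map => e /=; rewrite /tevent /= telt_inl.
Qed.

Lemma tconfig_emb (s : presentation E) :
  @tconfig (reos E) [seq (emb y.1, y.2) | y <- s] = tconfig s.
Proof.
rewrite /tconfig -map_comp; congr Node; apply: eq_map => y /=.
by rewrite telt_inl.
Qed.

Lemma g_reduceE : g_reduce X = tcov (sval (reduce x)).
Proof.
rewrite /g_reduce g_preE g_postE g_idleE g_rtypE g_reventsE.
by rewrite /tcov /= !tconfig_emb.
Qed.
End GReduce.

Lemma ptime_computable (A B : Type) (encA : A -> seq symbol) (encB : B -> seq symbol)
    (f : A -> B) (tA : A -> tree) (g : tree -> tree) :
  ptime g -> (forall x, enc (tA x) = encA x) ->
  (forall x, enc (g (tA x)) = encB (f x)) -> poly_time_computable encA encB f.
Proof.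
(* For a nonempty input of length [k], [k + 2 <= 3 * k] gives the factor [3 ^ c]; the summand
   [2 ^ c] is the bound at length 0, and [c] makes the exponent large enough. *)
move=> /ptimeE [M [c [_ eM]]] eA eB; exists (mach_TM M), (3 ^ c + 2 ^ c + c) => x.
pose t0 : tapes := (tm_init (mach_TM M) (encA x)).2.
have ht0 : holds t0 (stk (enc (tA x) ++ [::]) [::] [::]).
  move=> i; rewrite ffunE cats0 eA; exists 0, 0; split=> //=; rewrite cats0.
  by case: i => [[|[|[|[|i]]]] lti].
have [t' [n [le ht' ev]]] := exec_run (eM (tA x) [::] _ (leqnn _)) ht0.
exists n.
  apply: leq_trans le _; rewrite eA; move: (size _) => k.
  case: k => [|k]; first by apply: leq_trans (leq_addl _ _); rewrite add0n addnAC leq_addl.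
  apply: (@leq_trans ((3 * k.+1) ^ c)).
    by case: (c) => // c'; rewrite leq_exp2r //; lia.
  rewrite expnMn; apply: leq_trans (leq_addr _ _); apply: leq_mul; first by rewrite -addnA leq_addr.
  by rewrite leq_pexp2l // leq_addl.
exists (None, t'); split=> //; first by have := mexec_iter ev.
have [j [k [_ e]]] := ht' ord0; exists (nseq k None); last by case: k {e}.
by rewrite e /= cats0 eB.
Qed.

Lemma reduce_poly_time :
  poly_time_computable enc_cov (fun y => enc_cov (sval y)) reduce.
Proof.
apply: (ptime_computable ptime_reduce enc_tcov) => x.
by rewrite g_reduceE enc_tcov.
Qed.

(** * Correctness of the reduction *)

Local Notation Forall2 := List.Forall2.

(** [le_f] pairs the nested tokens of two lists presenting multisets, so pairings have to be carried
    along permutations. *)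
Lemma Forall2_perm (T : eqType) (U : eqType) (R : T -> U -> Prop) s s' t :
  Forall2 R s s' -> perm_eq s t -> exists2 t', perm_eq s' t' & Forall2 R t t'.
Proof.
move=> H; elim: H t => [|x x' {}s {}s' Rx _ IH] t pt.
  by exists [::] => //; rewrite perm_sym in pt; rewrite (perm_nilP pt); constructor.
have xt : x \in t by rewrite -(perm_mem pt) mem_head.
case/splitPr: t / xt pt => t1 t2 pt.
have /IH [u pu] : perm_eq s (t1 ++ t2).
  by rewrite -(perm_cons x) (permPl pt) -cat1s perm_catCA.
case/List.Forall2_app_inv_l => u1 [u2 [H1 [H2 eu]]].
exists (u1 ++ x' :: u2); last by apply: List.Forall2_app => //; constructor.
by rewrite eu -(perm_cons x') in pu; rewrite (permPl pu) -cat1s perm_catCA.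
Qed.

Lemma Forall2_map (A B C D : Type) (f : A -> B) (g : C -> D) (R : B -> D -> Prop) s t :
  Forall2 (fun x y => R (f x) (g y)) s t -> Forall2 R (map f s) (map g t).
Proof. by elim=> [|x y s' t' Rxy _ IH]; constructor. Qed.

Lemma Forall2_refl (A : Type) (R : A -> A -> Prop) s : (forall x, R x x) -> Forall2 R s s.
Proof. by move=> r; elim: s => [|x s IH]; constructor. Qed.

Lemma Forall2_trans (A : Type) (R : A -> A -> Prop) :
  (forall x y z, R x y -> R y z -> R x z) ->
  forall s t u, Forall2 R s t -> Forall2 R t u -> Forall2 R s u.
Proof.
move=> tr s t u H; elim: H u => [|x y s' t' Rxy _ IH] u H.
  by inversion H; constructor.
by inversion H; subst; constructor; [apply: tr Rxy _ | apply: IH].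
Qed.

Lemma seq_mset_cat (K : choiceType) (s t : seq K) :
  seq_mset (s ++ t) = (seq_mset s `+` seq_mset t)%mset.
Proof. by apply/msetP => x; rewrite msetE2 !mset_seqE count_cat. Qed.

(** * Counting object tokens; firing and [le_f] in terms of lists *)

Section Tokens.
Variable E : eos.
Implicit Types (x y : ntoken E) (s t r : seq (ntoken E)).

Definition tokens (N : obj E) (q : place (net N)) x : nat :=
  untag 0 (fun m : marking (net N) => m q) (content x).

Definition total s (N : obj E) (q : place (net N)) : nat := \sum_(x <- s) tokens q x.

Definition at_place s p : nat := \sum_(x <- s | nplace x == p) 1.

Lemma tokens_same p (m : marking (net (typ p))) q : tokens q (@NTok E p m) = m q.
Proof. by rewrite /tokens (untagE _ _ (erefl : tag (content (NTok m)) = typ p)). Qed.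

Lemma tokens_dflt x N (q : place (net N)) : N != typ (nplace x) -> tokens q x = 0.
Proof. by move=> ne; rewrite /tokens untag_dflt // eq_sym. Qed.

(** Contents are given by a family over all nets, which spares transporting a marking along an
    equality of types. *)
Lemma tokens_fun p (F : forall N : obj E, place (net N) -> nat) N q :
  tokens q (@NTok E p [ffun q' => F (typ p) q']) = if N == typ p then F N q else 0.
Proof.
case: (eqVneq N (typ p)) => [/esym e|ne]; last by rewrite tokens_dflt.
by case: N / e q => q; rewrite tokens_same ffunE.
Qed.

Lemma ntoken_leP x y : ntoken_le x y <->
  nplace x = nplace y /\ forall N (q : place (net N)), tokens q x <= tokens q y.
Proof.
split=> [[p m m' le]|[]].
  split=> // N q; case: (eqVneq N (typ p)) => [/esym e|ne]; last by rewrite !tokens_dflt.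
  by case: N / e q => q; rewrite !tokens_same.
case: x y => [p m] [p' m'] /= e; case: p' / e m' => m' le.
by apply: NTokenLe => q; rewrite -!tokens_same; apply: le.
Qed.

Lemma ntoken_le_refl x : ntoken_le x x.
Proof. exact/ntoken_leP. Qed.

Lemma ntoken_le_trans x y z : ntoken_le x y -> ntoken_le y z -> ntoken_le x z.
Proof.
move=> /ntoken_leP [e1 le1] /ntoken_leP [e2 le2]; apply/ntoken_leP.
by split=> [|N q]; [rewrite e1 | apply: leq_trans (le2 N q)].
Qed.

Lemma total_cons x s N (q : place (net N)) : total (x :: s) q = tokens q x + total s q.
Proof. by rewrite /total big_cons. Qed.

Lemma total_cat s t N (q : place (net N)) : total (s ++ t) q = total s q + total t q.
Proof. by rewrite /total big_cat. Qed.

Lemma at_place_cat s t p : at_place (s ++ t) p = at_place s p + at_place t p.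
Proof. by rewrite /at_place big_cat. Qed.

Lemma at_placeE s p : at_place s p = count (pred1 p) (map (@nplace E) s).
Proof. by rewrite /at_place sum1_count count_map. Qed.

Lemma Forall2_le_total s t : Forall2 (@ntoken_le E) s t ->
  forall N (q : place (net N)), total s q <= total t q.
Proof.
move=> H N q; elim: H => // x y s' t' /ntoken_leP [_ le] _ IH.
by rewrite !total_cons leq_add.
Qed.

Lemma Forall2_le_place s t : Forall2 (@ntoken_le E) s t -> at_place s =1 at_place t.
Proof.
move=> H p; rewrite !at_placeE; congr count.
by elim: H => //= x y s' t' /ntoken_leP [-> _] _ ->.
Qed.

(** Greedily, each nested token keeps as many object tokens as are still wanted. *)
Lemma shrink s (g : forall N : obj E, place (net N) -> nat) :
  (forall N (q : place (net N)), g N q <= total s q) ->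
  exists2 t, Forall2 (@ntoken_le E) t s & forall N (q : place (net N)), total t q = g N q.
Proof.
elim: s g => [|x s IH] g le.
  exists [::] => [|N q]; first by constructor.
  by have := le N q; rewrite /total big_nil leqn0 => /eqP ->.
pose F N (q : place (net N)) := minn (tokens q x) (g N q).
pose x' := @NTok E (nplace x) [ffun q => F (typ (nplace x)) q].
have x'E N q : tokens q x' = F N q.
  rewrite tokens_fun; case: eqP => // /eqP ne.
  by rewrite /F tokens_dflt // min0n.
have [t le_t tE] : exists2 t, Forall2 (@ntoken_le E) t s &
    forall N (q : place (net N)), total t q = g N q - tokens q x'.
  apply: (IH (fun N q => g N q - tokens q x')) => N q.
  by have := le N q; rewrite total_cons x'E /F; lia.
exists (x' :: t) => [|N q].
  by constructor => //; apply/ntoken_leP; split=> // N q; rewrite x'E geq_minl.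
by rewrite total_cons tE x'E /F; lia.
Qed.

(** The first nested token of type [N] takes the whole surplus of [N]; the second hypothesis ensures
    that there is one. *)
Lemma grow s (g : forall N : obj E, place (net N) -> nat) :
  (forall N (q : place (net N)), total s q <= g N q) ->
  (forall N (q : place (net N)), total s q < g N q -> has (fun x => typ (nplace x) == N) s) ->
  exists2 t, Forall2 (@ntoken_le E) s t & forall N (q : place (net N)), total t q = g N q.
Proof.
elim: s g => [|x s IH] g le ex.
  exists [::] => [|N q]; first by constructor.
  by apply/eqP; rewrite eqn_leq le leqNgt; apply/negP => /ex.
pose F N (q : place (net N)) := g N q - total s q.
pose x' := @NTok E (nplace x) [ffun q => F (typ (nplace x)) q].
have x'E N q : tokens q x' = if N == typ (nplace x) then F N q else 0.
  exact: tokens_fun.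
have [t le_t tE] : exists2 t, Forall2 (@ntoken_le E) s t &
    forall N (q : place (net N)), total t q = if N == typ (nplace x) then total s q else g N q.
  apply: (IH (fun N q => if N == typ (nplace x) then total s q else g N q)) => N q.
    by case: ifP => // _; apply: leq_trans (le N q); rewrite total_cons leq_addl.
  case: (eqVneq N (typ (nplace x))) => [_|ne]; first by rewrite ltnn.
  move=> lt; have := ex N q; rewrite total_cons tokens_dflt // add0n => /(_ lt) /=.
  by rewrite eq_sym (negbTE ne).
exists (x' :: t) => [|N q].
  constructor => //; apply/ntoken_leP; split=> // N q; rewrite x'E.
  case: (eqVneq N (typ (nplace x))) => [_|/tokens_dflt -> //].
  by have := le N q; rewrite total_cons /F; lia.
rewrite total_cons tE x'E /F; case: (eqVneq N (typ (nplace x))) => [_|//].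
by have := le N q; rewrite total_cons; lia.
Qed.

Definition transforms (e : event E) la rh : Prop :=
  [/\ forall p, at_place la p = pre e.1 p,
      forall p, at_place rh p = post e.1 p
    & forall N (q : place (net N)),
        mpre (e.2 N) q <= total la q /\
        total rh q = total la q - mpre (e.2 N) q + mpost (e.2 N) q].

(** The untouched rest [r] is named explicitly, so multiset differences disappear from the later
    arguments. *)
Lemma firesP (mu mu' : config E) : fires mu mu' <->
  exists e la rh r, [/\ e \in events E, mu = seq_mset (la ++ r), mu' = seq_mset (rh ++ r)
    & transforms e la rh].
Proof.
have P1 s p : Pi1 (seq_mset s) p = at_place s p by apply: perm_big; apply: perm_eq_seq_mset.
have P2 s N (q : place (net N)) : Pi2 (seq_mset s) q = total s q.
  by apply: perm_big; apply: perm_eq_seq_mset.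
split=> [[e eE [la [rh [sub p1 p2 p3 ->]]]]|[e [la [rh [r [eE -> -> [p1 p2 p3]]]]]]].
  exists e, la, rh, (mu `\` la)%mset.
  rewrite !seq_mset_cat !seq_mset_id msetBDKC // msetDC; split=> //.
exists e => //; exists (seq_mset la), (seq_mset rh); split.
- by apply/msubsetP => x; rewrite !mset_seqE count_cat leq_addr.
- by move=> p; rewrite P1.
- by move=> p; rewrite P1.
- by move=> N q; rewrite !P2.
- by rewrite !seq_mset_cat msetDKB msetDC.
Qed.

Lemma le_f_cat s t r : Forall2 (@ntoken_le E) s t -> le_f (seq_mset s) (seq_mset (t ++ r)).
Proof. by move=> H; exists s, t, r. Qed.

(** Yields the nested tokens of the larger configuration that stand for the consumed part [s]; the
    partners of [r] and the added nested tokens make up [r']. *)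
Lemma le_f_split s r (mu : config E) : le_f (seq_mset (s ++ r)) mu ->
  exists t r', [/\ mu = seq_mset (t ++ r'), Forall2 (@ntoken_le E) s t
                 & le_f (seq_mset r) (seq_mset r')].
Proof.
case=> [u [u' [w [e -> H]]]]; move/eq_seq_msetP: e; rewrite perm_sym => pu.
have [v pv] := Forall2_perm H pu.
case/List.Forall2_app_inv_l => v1 [v2 [H1 [H2 ev]]].
exists v1, (v2 ++ w); split=> //; last exact: le_f_cat.
by apply/eq_seq_msetP; rewrite catA -[v1 ++ v2]/(app v1 v2) -ev perm_cat2r.
Qed.

Lemma le_f_trans (mu nu xi : config E) : le_f mu nu -> le_f nu xi -> le_f mu xi.
Proof.
case=> [s [s' [r [-> -> H]]]] /le_f_split [t [r' [-> H' _]]].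
exists s, t, r'; split=> //; exact: (Forall2_trans ntoken_le_trans) H H'.
Qed.

Lemma le_f_add s t r r' : Forall2 (@ntoken_le E) s t -> le_f (seq_mset r) (seq_mset r') ->
  le_f (seq_mset (s ++ r)) (seq_mset (t ++ r')).
Proof.
move=> H [u [u' [w [/eq_seq_msetP eu /eq_seq_msetP er Hu]]]].
exists (s ++ u), (t ++ u'), w; split; last exact: List.Forall2_app.
  by apply/eq_seq_msetP; rewrite perm_cat2l.
by apply/eq_seq_msetP; rewrite -catA perm_cat2l.
Qed.

Lemma le_f_refl (mu : config E) : le_f mu mu.
Proof.
rewrite -(seq_mset_id mu); set s : seq (ntoken E) := mu.
by rewrite -{2}[s]cats0; apply: le_f_cat; apply: Forall2_refl ntoken_le_refl.
Qed.
End Tokens.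

(** * Simulation in both directions *)

Section Simulation.
Variable E : eos.
Implicit Types (s t r la rh : seq (ntoken E)).

Definition proj (x : ntoken (reos E)) : option (ntoken E) :=
  match x with
  | existT (inl p) m => Some (@NTok E p m)
  | existT (inr _) _ => None
  end.

Lemma embK : pcancel (@emb E) proj.
Proof. by case. Qed.

Lemma projK (x : ntoken (reos E)) y : proj x = Some y -> x = emb y.
Proof. by case: x => [[p|n] m] //= [<-]. Qed.

Lemma pmap_emb s : pmap proj (map (@emb E) s) = s.
Proof. exact: map_pK embK s. Qed.

Lemma tokens_emb x (N : obj E) (q : place (net N)) : @tokens (reos E) N q (emb x) = tokens q x.
Proof. by []. Qed.

Lemma total_emb s (N : obj E) (q : place (net N)) :
  @total (reos E) (map (@emb E) s) N q = total s q.
Proof. by rewrite /total big_map; apply: eq_bigr => x _. Qed.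

Lemma at_place_emb s p : @at_place (reos E) (map (@emb E) s) p =
  if p is inl p' then at_place s p' else 0.
Proof.
rewrite /at_place big_map; case: p => [p|n]; last by rewrite big_pred0.
by apply: eq_bigl => x; rewrite /emb.
Qed.

Lemma total_proj (s : seq (ntoken (reos E))) (N : obj E) (q : place (net N)) :
  total (pmap proj s) q <= @total (reos E) s N q.
Proof.
elim: s => [|x s IH]; first by rewrite /total !big_nil.
rewrite [X in _ <= X]total_cons /=; case e: (proj x) => [y|] /=; last first.
  exact: leq_trans (leq_addl _ _).
by rewrite total_cons (projK e) tokens_emb leq_add2l.
Qed.

Lemma at_place_proj (s : seq (ntoken (reos E))) p :
  at_place (pmap proj s) p = @at_place (reos E) s (inl p).
Proof.
rewrite !at_placeE; elim: s => //= x s <-.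
by case: x => [[p'|n] m].
Qed.

(** Applies to the input of an ordinary transition, which takes nothing from the trash. *)
Lemma emb_of_proj (s : seq (ntoken (reos E))) :
  (forall n, @at_place (reos E) s (inr n) = 0) -> s = map (@emb E) (pmap proj s).
Proof.
elim: s => //= x s IH H; have H1 n : @at_place (reos E) s (inr n) = 0.
  by have := H n; rewrite !at_placeE /=; lia.
case: x H => [[p|n] m] /= H; first by rewrite -IH.
by have := H n; rewrite at_placeE /= eqxx.
Qed.

Lemma emb_le (x y : ntoken E) : ntoken_le x y -> ntoken_le (emb x) (emb y).
Proof. by case=> p m m' le; apply: (@NTokenLe (reos E) (inl p)). Qed.

Lemma proj_le (x : ntoken E) (y : ntoken (reos E)) : ntoken_le (emb x) y ->
  exists2 z, proj y = Some z & ntoken_le x z.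
Proof.
move=> /ntoken_leP [ep le]; case: y ep le => [[p|n] m] //= [ep] le.
by exists (@NTok E p m) => //; apply/ntoken_leP; split=> // N q; apply: le.
Qed.

Lemma Forall2_proj s (t : seq (ntoken (reos E))) :
  Forall2 (@ntoken_le (reos E)) (map (@emb E) s) t ->
  Forall2 (@ntoken_le E) s (pmap proj t).
Proof.
elim: s t => [|x s IH] t H; inversion H; subst; first by constructor.
have [z e le] := proj_le H2; rewrite /= e /=; constructor => //; exact: IH.
Qed.

Lemma emb_le_f (mu mu' : config E) : le_f mu mu' ->
  le_f (seq_mset (map (@emb E) mu)) (seq_mset (map (@emb E) mu')).
Proof.
case=> [s [s' [r [-> -> H]]]].
exists (map (@emb E) s), (map (@emb E) s'), (map (@emb E) r); split.
- by apply/eq_seq_msetP/perm_map/perm_eq_seq_mset.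
- by rewrite -map_cat; apply/eq_seq_msetP/perm_map/perm_eq_seq_mset.
- by apply: Forall2_map; elim: H => [|x y u v le _ IHu]; constructor => //; apply: emb_le.
Qed.

Lemma proj_le_f (mu : config E) (nu : config (reos E)) :
  le_f (seq_mset (map (@emb E) mu)) nu -> le_f mu (seq_mset (pmap proj nu)).
Proof.
rewrite -{2}(seq_mset_id mu) -[map _ _]cats0 => /le_f_split [t [r [-> H _]]].
exists mu, (pmap proj t), (pmap proj r); split=> //; last exact: Forall2_proj.
by rewrite -pmap_cat; apply/eq_seq_msetP/perm_pmap/perm_eq_seq_mset.
Qed.

Lemma live_mpost (e : event E) n (q : place (net n)) : live e -> 0 < mpost (e.2 n) q ->
  exists2 p, 0 < post e.1 p & typ p = n.
Proof.
move=> /forallP /(_ n) /orP [/existsPn H|/existsP [p /andP [p0 /eqP e1]]].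
  rewrite /mpost lt0n sum_nat_eq0 => /forallPn [u].
  rewrite negb_imply /= muln_eq0 negb_or => /andP [u0 uq].
  by have := H u; rewrite u0 /= => /existsPn /(_ q); rewrite uq.
by move=> _; exists p => //; rewrite lt0n.
Qed.

(** A produced token must lie in some nested token of [rh], whose place is then an output place of
    the right type. So deleting the other events removes no firing of [E]. *)
Lemma fires_live (e : event E) la rh : transforms e la rh -> live e.
Proof.
move=> [_ p2 p3]; apply/forallP => n; case: (boolP [exists u, _]) => //= /existsP [u].
case/andP=> u0 /existsP [q uq]; apply/existsP.
have : 0 < total rh q.
  have [_ ->] := p3 n q; rewrite addn_gt0; apply/orP; right.
  by rewrite /mpost (bigD1 u) //= addn_gt0 muln_gt0 !lt0n u0 uq.
rewrite lt0n /total sum_nat_seq_neq0 => /hasP [x xr].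
rewrite /= => tx; exists (nplace x); apply/andP; split; last first.
  by apply: contraNT tx; rewrite eq_sym => /tokens_dflt ->.
rewrite -p2 at_placeE -lt0n -has_count has_map; apply/hasP; exists x => //=.
Qed.

(** The partners [la'] of the consumed nested tokens may carry more than [la]; the firing sends
    exactly this excess to the trash. *)
Lemma simulate_fires (mu mu' : config E) (nu : config (reos E)) :
  fires mu mu' -> le_f (seq_mset (map (@emb E) mu)) nu ->
  exists2 nu', fires nu nu' & le_f (seq_mset (map (@emb E) mu')) nu'.
Proof.
have perm_emb s : seq_mset (map (@emb E) (seq_mset s)) = seq_mset (map (@emb E) s).
  by apply/eq_seq_msetP/perm_map/perm_eq_seq_mset.
move=> /firesP [e [la [rh [r [eE -> -> tr]]]]].
rewrite !perm_emb !map_cat => /le_f_split [la' [r' [-> Hla Hr]]].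
have lv := fires_live tr; case: tr => p1 p2 p3.
have le_la (N : obj E) (q : place (net N)) := Forall2_le_total Hla q.
(* The object tokens of [la'] beyond those of [la]. Put into the trash, they make the balance of the
   firing exact while the remaining output is that of [E]. *)
pose F (N : obj E) (q : place (net N)) := @total (reos E) la' N q - total la q.
pose trash : seq (ntoken (reos E)) :=
  [seq @NTok (reos E) (inr n) [ffun q => F n q] | n <- enum (obj E)].
have trash_total N q : @total (reos E) trash N q = F N q.
  rewrite /total big_map (eq_bigr (fun n => if N == n then F N q else 0)); last first.
    by move=> n _; apply: (@tokens_fun (reos E) (inr n) F).
  by rewrite big_enum -big_mkcond (big_pred1 N) // => n; rewrite eq_sym.
have trash_place p : at_place trash p = if p is inr _ then 1 else 0.
  rewrite at_placeE -map_comp; case: p => [p|n].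
    by rewrite count_map; apply/eqP; rewrite -leqn0 leqNgt -has_count; apply/hasPn.
  by rewrite count_map (eq_count (a2 := pred1 n)) // count_uniq_mem ?enum_uniq // mem_enum.
exists (seq_mset ((map (@emb E) rh ++ trash) ++ r')); last first.
  rewrite -catA; apply: le_f_add; first exact: Forall2_refl (@ntoken_le_refl _).
  (* The trash only adds nested tokens, which [le_f] permits. *)
  apply: le_f_trans Hr _; exists r', r', trash; split=> //.
    by apply/eq_seq_msetP; rewrite perm_catC.
  exact: Forall2_refl (@ntoken_le_refl _).
apply/firesP; exists ((inl e.1, e.2) : event (reos E)), la', (map (@emb E) rh ++ trash), r'.
split=> //.
  by apply/mapP; exists e => //; rewrite mem_filter lv.
split=> [p|p|N q].
- by rewrite -(Forall2_le_place Hla) at_place_emb; case: p => // p; rewrite p1.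
- by rewrite at_place_cat at_place_emb trash_place; case: p => // p; rewrite p2 addn0.
have [le1 e1] := p3 N q; have le2 := le_la N q; rewrite total_emb in le2.
rewrite total_cat total_emb trash_total e1 /F /=.
by split; first exact: leq_trans le2; move: le1 le2; lia.
Qed.

(** Without the trash, the output may hold less than the balance of the event requires. The deficit
    is split: carried-over tokens are lost before the event fires in [E], produced ones after it. *)
Lemma simulate_lossy (nu nu' : config (reos E)) : fires nu nu' ->
  lossy_run (seq_mset (pmap proj nu)) (seq_mset (pmap proj nu')).
Proof.
have perm_proj (s : seq (ntoken (reos E))) :
    seq_mset (pmap proj (seq_mset s)) = seq_mset (pmap proj s).
  by apply/eq_seq_msetP/perm_pmap/perm_eq_seq_mset.
move=> /firesP [e' [la' [rh' [r' [/mapP [e + ee] -> -> [p1 p2 p3]]]]]].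
rewrite mem_filter {}ee in p1 p2 p3 * => /andP [lv eE].
rewrite !perm_proj !pmap_cat; set la := pmap proj la'; set rh := pmap proj rh'.
set r := pmap proj r'.
have la'E : la' = map (@emb E) la by apply: emb_of_proj => n; rewrite p1.
have q1 p : at_place la p = pre e.1 p by rewrite at_place_proj p1.
have q2 p : at_place rh p = post e.1 p by rewrite at_place_proj p2.
have q3 (N : obj E) (q : place (net N)) : mpre (e.2 N) q <= total la q /\
    total rh q <= total la q - mpre (e.2 N) q + mpost (e.2 N) q.
  have [le1 e1] := p3 N q; rewrite {1}la'E total_emb in le1; split=> //.
  have := total_proj rh' q; rewrite e1 {1}la'E total_emb; exact: leq_trans.
(* The tokens the event consumes and those of [rh] it does not produce: the least content from which
   one firing reaches at least [rh]. The firing yields the maximum of [rh] and the produced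
   tokens. *)
have [lam Hlam lamE] := @shrink E la
  (fun N q => mpre (e.2 N) q + (total rh q - mpost (e.2 N) q)) (fun N q =>
  ltac:(case: (q3 N q) => ? ?; lia)).
have [rhp Hrhp rhpE] : exists2 t, Forall2 (@ntoken_le E) rh t &
    forall (N : obj E) (q : place (net N)), total t q = mpost (e.2 N) q + (total rh q - mpost (e.2 N) q).
  apply: (@grow E rh (fun N q => mpost (e.2 N) q + (total rh q - mpost (e.2 N) q))) => N q.
    by lia.
  (* The event produces more than [rh] holds, hence at least one token of [N]; liveness then gives
     an output place of type [N], and [rh] has a nested token there to receive the surplus. *)
  move=> lt; have [|p p0 pN] := @live_mpost e N q lv.
    by rewrite lt0n; apply: contraTneq lt => ->; rewrite add0n subn0 ltnn.
  move: p0; rewrite -q2 at_placeE -has_count has_map => /hasP [x xr /= /eqP xp].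
  by apply/hasP; exists x => //; rewrite xp pN.
apply: (@rt1n_trans _ _ _ (seq_mset (lam ++ r))).
  by right; apply: le_f_add Hlam (le_f_refl _).
apply: (@rt1n_trans _ _ _ (seq_mset (rhp ++ r))).
  left; apply/firesP; exists e, lam, rhp, r; split=> //; split=> [p|p|N q].
  - by rewrite (Forall2_le_place Hlam) q1.
  - by rewrite -(Forall2_le_place Hrhp) q2.
  - by rewrite lamE rhpE leq_addr addKn addnC.
apply: (@rt1n_trans _ _ _ (seq_mset (rh ++ r))); last exact: rt1n_refl.
by right; apply: le_f_add Hrhp (le_f_refl _).
Qed.

Lemma lossy_run_trans (mu nu xi : config E) :
  lossy_run mu nu -> lossy_run nu xi -> lossy_run mu xi.
Proof. by elim=> // a b c ab _ IH /IH; apply: rt1n_trans. Qed.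

(** The invariant is that the conservative configuration dominates the embedded one. A lossy step of
    [E] preserves it by transitivity and needs no counterpart. *)
Lemma run_simulates (mu mu' : config E) (nu : config (reos E)) :
  lossy_run mu mu' -> le_f (seq_mset (map (@emb E) mu)) nu ->
  exists2 nu', run nu nu' & le_f (seq_mset (map (@emb E) mu')) nu'.
Proof.
move=> H; elim: H nu => [a|a b c ab _ IH] nu le; first by exists nu => //; apply: rt1n_refl.
case: ab => [/simulate_fires /(_ le) [nu1 f1 /IH [nu2 r2 le2]]|ba].
  by exists nu2 => //; apply: rt1n_trans f1 r2.
by apply: IH; apply: le_f_trans (emb_le_f ba) le.
Qed.

Lemma lossy_run_simulates (nu nu' : config (reos E)) : run nu nu' ->
  lossy_run (seq_mset (pmap proj nu)) (seq_mset (pmap proj nu')).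
Proof.
by elim=> [a|a b c /simulate_lossy ab _]; [apply: rt1n_refl | apply: lossy_run_trans].
Qed.

Lemma config_of_emb (s : presentation E) :
  @config_of (reos E) [seq (emb y.1, y.2) | y <- s] = seq_mset (map (@emb E) (config_of s)).
Proof.
rewrite /config_of.
have -> : tally_seq [seq (emb y.1, y.2) | y <- s] = map (@emb E) (tally_seq s).
  by elim: s => //= -[x k] s /= IH; rewrite map_cat map_nseq -IH.
by apply/eq_seq_msetP; rewrite perm_sym; apply: perm_map; apply: perm_eq_seq_mset.
Qed.

Lemma proj_config (mu : config E) : seq_mset (pmap proj (seq_mset (map (@emb E) mu))) = mu.
Proof.
rewrite -[RHS]seq_mset_id; apply/eq_seq_msetP.
by rewrite -{2}(pmap_emb mu); apply: perm_pmap; apply: perm_eq_seq_mset.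
Qed.
End Simulation.

(** The embedded target contains no trash token, so covering it survives both surplus tokens and the
    removal of the trash. *)
Lemma reduce_correct (x : pb_instance EOS_lossy_coverability) :
  pb_yes x <-> pb_yes (reduce x).
Proof.
rewrite /= !config_of_emb; set mu0 := config_of (ci_init x); set mu1 := config_of _.
split=> [[mu lr le]|[nu r le]].
  have [nu rn le'] := run_simulates lr (le_f_refl _); exists nu => //.
  exact: le_f_trans (emb_le_f le) le'.
exists (seq_mset (pmap (@proj _) nu)); last exact: proj_le_f.
by have := lossy_run_simulates r; rewrite proj_config.
Qed.

Theorem theorem6 :
  exists f : pb_instance EOS_lossy_coverability -> pb_instance cEOS_coverability,
    poly_time_reduction f.
Proof.
exists reduce; split; [exact: reduce_poly_time | exact: reduce_correct].
Qed.
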